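(* Let $Q$ be a sink projective representation quiver and let $R$ be a Gorenstein ring. A representation $\mathcal{M}\in(Q,R\text{-Mod})$ is Gorenstein projective if and only if for each vertex $v$ of $Q$, $\mathcal{M}(v)$ is a Gorenstein projective left $R$-module, the sequence $$0\to\bigoplus_{t(a)=v}\mathcal{M}(s(a))\xrightarrow{f_v}\mathcal{M}(v)\to\mathcal{C}(v)\to0$$ is exact and $\mathcal{C}(v)$ is a Gorenstein projective left $R$-module, where $f_v:\bigoplus_{t(a)=v}\mathcal{M}(s(a))\to\mathcal{M}(v)$ is the map induced by the maps $\mathcal{M}(a):\mathcal{M}(s(a))\to\mathcal{M}(v)$ and $\mathcal{C}(v)$ is the cokernel of $f_v$.
   Context: Rings are associative with identity, not necessarily commutative. A quiver $Q$ consists of a set $V$ of vertices, a set $\Gamma$ of arrows and source and target maps $s,t:\Gamma\to V$; both sets may be infinite, and loops and multiple arrows are allowed. $(Q,R\text{-Mod})$ is the category of representations of $Q$ by left $R$-modules: a representation $\mathcal{X}$ assigns a left $R$-module $\mathcal{X}(v)$ to each vertex $v$ and a homomorphism $\mathcal{X}(a):\mathcal{X}(s(a))\to\mathcal{X}(t(a))$ to each arrow $a$; morphisms are natural transformations. A quiver $Q$ is a sink projective representation quiver if for every ring $R$ and every $\mathcal{X}\in(Q,R\text{-Mod})$: $\mathcal{X}$ is projective if and only if (i') $\mathcal{X}(v)$ is a projective $R$-module for every vertex $v$ and (ii') for every vertex $v$ the morphism $\bigoplus_{t(a)=v}\mathcal{X}(s(a))\to\mathcal{X}(v)$ induced by the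 maps $\mathcal{X}(a)$ is a splitting monomorphism. A Gorenstein ring (in the sense of Iwanaga) is a left and right noetherian ring having finite injective dimension both as a left and as a right module over itself. An object $M$ of an abelian category is Gorenstein projective if there is an exact sequence $\cdots\to P_{-2}\to P_{-1}\to P_0\to P_1\to P_2\to\cdots$ of projective objects with $M=\ker(P_0\to P_1)$ which remains exact after applying $\mathrm{Hom}(-,P)$ for every projective object $P$. *)

(* Defs.v *)
From HB Require Import structures.
From mathcomp Require Import all_boot all_order all_algebra.
From mathcomp Require Import finmap boolp classical_sets functions cardinality fsbigop.

Set Implicit Arguments.
Unset Strict Implicit.
Unset Printing Implicit Defensive.

Import GRing.Theory.
Local Open Scope ring_scope.
Local Open Scope quotient_scope.
Local Open Scope classical_set_scope.

(* The notions below are the usual ones of an abelian category; since they     *)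
(* only involve composition and zero morphisms, they are stated in any         *)
(* category with zero morphisms.                                               *)

Record category0 := Category0 {
  obj :> Type;
  hom : obj -> obj -> Type;
  idm : forall A, hom A A;
  comp : forall A B C, hom B C -> hom A B -> hom A C;
  zerom : forall A B, hom A B;
  compmA : forall A B C D (h : hom C D) (g : hom B C) (f : hom A B),
    comp h (comp g f) = comp (comp h g) f;
  comp1m : forall A B (f : hom A B), comp (idm B) f = f;
  compm1 : forall A B (f : hom A B), comp f (idm A) = f;
  comp0m : forall A B C (f : hom A B), comp (zerom B C) f = zerom A C;
  compm0 : forall A B C (g : hom B C), comp g (zerom A B) = zerom A C
}.

Arguments idm {_} _.
Arguments comp {_ _ _ _} _ _.
Arguments zerom {_} _ _.

Notation "g '\oc' f" := (comp g f) (at level 50, left associativity).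

Section Category0Theory.
Variable C : category0.

Definition is_mono (A B : C) (f : hom A B) : Prop :=
  forall (T : C) (g h : hom T A), f \oc g = f \oc h -> g = h.

Definition is_epi (A B : C) (f : hom A B) : Prop :=
  forall (T : C) (g h : hom B T), g \oc f = h \oc f -> g = h.

Definition is_split_mono (A B : C) (f : hom A B) : Prop :=
  exists r : hom B A, r \oc f = idm A.

Definition is_zero_obj (A : C) : Prop := idm A = zerom A A.

Definition is_kernel (K A B : C) (g : hom A B) (k : hom K A) : Prop :=
  g \oc k = zerom K B /\
  forall (T : C) (h : hom T A), g \oc h = zerom T B ->
    exists! h' : hom T K, k \oc h' = h.

(* Exactness of A -> B -> D at B: f corestricts to an epimorphism onto the     *)
(* kernel of g, that is, the image of f is the kernel of g.                    *)
Definition is_exact (A B D : C) (f : hom A B) (g : hom B D) : Prop :=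
  exists (K : C) (k : hom K B) (e : hom A K),
    [/\ is_kernel g k, is_epi e & f = k \oc e].

Definition is_short_exact (A B D : C) (f : hom A B) (g : hom B D) : Prop :=
  [/\ is_mono f, is_exact f g & is_epi g].

Definition is_projective (P : C) : Prop :=
  forall (A B : C) (g : hom A B), is_epi g ->
  forall h : hom P B, exists h' : hom P A, g \oc h' = h.

Definition is_injective (E : C) : Prop :=
  forall (A B : C) (g : hom A B), is_mono g ->
  forall h : hom A E, exists h' : hom B E, h' \oc g = h.

(* An exact sequence 0 -> M -> E 0 -> ... -> E n -> 0 with injective E k,      *)
(* prolonged by zero.                                                          *)
Definition finite_injdim (M : C) : Prop :=
  exists (n : nat) (E : nat -> C) (eps : hom M (E 0%N))
         (d : forall k, hom (E k) (E k.+1)),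
    [/\ forall k, is_injective (E k),
        forall k, (n < k)%N -> is_zero_obj (E k),
        is_mono eps,
        is_exact eps (d 0%N) &
        forall k, is_exact (d k) (d k.+1)].

Definition is_gproj (M : C) : Prop :=
  exists (P : int -> C) (d : forall i, hom (P i) (P (i + 1)))
         (k : hom M (P 0)),
    [/\ forall i, is_projective (P i),
        forall i, is_exact (d i) (d (i + 1)),
        is_kernel (d 0) k &
        forall L : C, is_projective L ->
        forall i (u : hom (P (i + 1)) L),
          u \oc d i = zerom (P i) L <->
          exists w : hom (P (i + 1 + 1)) L, u = w \oc d (i + 1)].

End Category0Theory.

Section LinearHom.
Variable R : pzRingType.

Fact linear_ext (A B : lmodType R) (f g : {linear A -> B}) : f =1 g -> f = g.
Proof.
case: f => f [[cf] [df]]; case: g => g [[cg] [dg]] /= /funext fg; subst g.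
by rewrite (Prop_irrelevance cf cg) (Prop_irrelevance df dg).
Qed.

Definition lin_id (A : lmodType R) : {linear A -> A} := idfun.
Definition lin_comp (A B C : lmodType R)
  (g : {linear B -> C}) (f : {linear A -> B}) : {linear A -> C} := g \o f.
Definition lin_zero (A B : lmodType R) : {linear A -> B} := \0.

Fact lin_compA (A B C D : lmodType R) (h : {linear C -> D}) (g : {linear B -> C})
  (f : {linear A -> B}) : lin_comp h (lin_comp g f) = lin_comp (lin_comp h g) f.
Proof. exact: linear_ext. Qed.
Fact lin_comp1 (A B : lmodType R) (f : {linear A -> B}) : lin_comp (lin_id B) f = f.
Proof. exact: linear_ext. Qed.
Fact lin_compr1 (A B : lmodType R) (f : {linear A -> B}) : lin_comp f (lin_id A) = f.
Proof. exact: linear_ext. Qed.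
Fact lin_comp0 (A B C : lmodType R) (f : {linear A -> B}) :
  lin_comp (lin_zero B C) f = lin_zero A C.
Proof. exact: linear_ext. Qed.
Fact lin_compr0 (A B C : lmodType R) (g : {linear B -> C}) :
  lin_comp g (lin_zero A B) = lin_zero A C.
Proof. by apply: linear_ext => x; apply: linear0. Qed.

Definition ModCat : category0 :=
  @Category0 (lmodType R) (fun A B => {linear A -> B}) lin_id lin_comp lin_zero
    lin_compA lin_comp1 lin_compr1 lin_comp0 lin_compr0.

End LinearHom.

Section DirectSum.
Variables (R : pzRingType) (I : choiceType) (M : I -> lmodType R).

Definition lprod : Type := forall i, M i.

HB.instance Definition _ := Choice.copy lprod (forall i, M i).

Definition lprod_zero : lprod := fun i => 0.
Definition lprod_opp (x : lprod) : lprod := fun i => - x i.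
Definition lprod_add (x y : lprod) : lprod := fun i => x i + y i.
Definition lprod_scale (a : R) (x : lprod) : lprod := fun i => a *: x i.

Fact lprod_addA : associative lprod_add.
Proof. by move=> x y z; apply: functional_extensionality_dep => i; apply: addrA. Qed.
Fact lprod_addC : commutative lprod_add.
Proof. by move=> x y; apply: functional_extensionality_dep => i; apply: addrC. Qed.
Fact lprod_add0 : left_id lprod_zero lprod_add.
Proof. by move=> x; apply: functional_extensionality_dep => i; apply: add0r. Qed.
Fact lprod_addN : left_inverse lprod_zero lprod_opp lprod_add.
Proof. by move=> x; apply: functional_extensionality_dep => i; apply: addNr. Qed.

HB.instance Definition _ :=
  GRing.isZmodule.Build lprod lprod_addA lprod_addC lprod_add0 lprod_addN.

Fact lprod_scaleA a b x : lprod_scale a (lprod_scale b x) = lprod_scale (a * b) x.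
Proof. by apply: functional_extensionality_dep => i; apply: scalerA. Qed.
Fact lprod_scale1 : left_id 1 lprod_scale.
Proof. by move=> x; apply: functional_extensionality_dep => i; apply: scale1r. Qed.
Fact lprod_scaleDr : right_distributive lprod_scale +%R.
Proof. by move=> a x y; apply: functional_extensionality_dep => i; apply: scalerDr. Qed.
Fact lprod_scaleDl x : {morph lprod_scale^~ x : a b / a + b}.
Proof. by move=> a b; apply: functional_extensionality_dep => i; apply: scalerDl. Qed.

HB.instance Definition _ := GRing.Zmodule_isLmodule.Build R lprod
  lprod_scaleA lprod_scale1 lprod_scaleDr lprod_scaleDl.

Definition lsupp (x : lprod) : set I := [set i | x i != 0].

Definition finsupp_pred : {pred lprod} := fun x => `[< finite_set (lsupp x) >].

Fact finsupp_submod_closed : submod_closed finsupp_pred.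
Proof.
split=> [|a x y /asboolP fx /asboolP fy]; apply/asboolP.
  rewrite (_ : lsupp _ = set0) //; apply/seteqP; split=> i //=.
  by rewrite /lsupp /= eqxx.
apply: (@sub_finite_set _ _ (lsupp x `|` lsupp y)); last by rewrite finite_setU.
move=> i; rewrite /lsupp /= => nz.
have [xi0|] := eqVneq (x i) 0; last by left.
right; apply: contraNneq nz => yi0.
by rewrite -[X in X == 0]/(a *: x i + y i) xi0 yi0 scaler0 addr0.
Qed.

HB.instance Definition _ :=
  GRing.isSubmodClosed.Build R lprod finsupp_pred finsupp_submod_closed.

(* The direct sum of the M i: families with finite support.                    *)
Record dsum := DSum { dsum_val :> lprod; _ : dsum_val \in finsupp_pred }.

HB.instance Definition _ := [isSub for dsum_val].
HB.instance Definition _ := [Choice of dsum by <:].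
HB.instance Definition _ := [SubChoice_isSubLmodule of dsum by <:].

Variables (N : lmodType R) (f : forall i, {linear M i -> N}).

(* The map induced on the direct sum; the sum ranges over the finitely many i  *)
(* with f i (x i) != 0.                                                        *)
Definition dsum_map (x : dsum) : N := \sum_(i \in [set: I]) f i ((x : lprod) i).

Fact dsum_map_linear : linear dsum_map.
Proof.
move=> a x y; have suppF (z : dsum) : finite_set (lsupp z).
  by apply/asboolP; case: z.
pose A := fset_set (lsupp x `|` lsupp y).
have finA : finite_set (lsupp x `|` lsupp y) by rewrite finite_setU.
have notA i : i \notin A -> (x : lprod) i = 0 /\ (y : lprod) i = 0.
  rewrite /A in_fset_set // notin_setE => /not_orP[/negP + /negP].
  by rewrite !negbK => /eqP-> /eqP->.
have axyE i : ((a *: x + y : dsum) : lprod) i = a *: (x : lprod) i + (y : lprod) i by [].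
rewrite /dsum_map (fsbigTE A) => [|i /notA[xi0 yi0]]; last first.
  by rewrite axyE xi0 yi0 scaler0 addr0 linear0.
rewrite (fsbigTE A) => [|i /notA[-> _]]; last by rewrite linear0.
rewrite (fsbigTE A) => [|i /notA[_ ->]]; last by rewrite linear0.
by rewrite scaler_sumr -big_split /=; apply: eq_bigr => i _; exact: linearP.
Qed.

HB.instance Definition _ :=
  GRing.isLinear.Build R dsum N *:%R dsum_map dsum_map_linear.

End DirectSum.

Section Cokernel.
Variables (R : pzRingType) (A B : lmodType R) (f : {linear A -> B}).

Definition im_pred : {pred B} := fun y => `[< exists x, f x = y >].

Fact im_zmod_closed : zmod_closed im_pred.
Proof.
split=> [|_ _ /asboolP[x <-] /asboolP[y <-]]; apply/asboolP.
  by exists 0; rewrite linear0.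
by exists (x - y); rewrite linearB.
Qed.

HB.instance Definition _ := GRing.isZmodClosed.Build B im_pred im_zmod_closed.

Definition coker : Type := Quotient.quot im_pred.

HB.instance Definition _ := GRing.Zmodule.on coker.

Definition coker_pi (y : B) : coker := \pi_(Quotient.quot im_pred) y.

Fact coker_pi_eq (x y : B) : coker_pi x = coker_pi y <-> exists z, f z = x - y.
Proof.
split=> [/eqP|[z zE]]; first by rewrite -Quotient.idealrBE => /asboolP.
by apply/eqP; rewrite -Quotient.idealrBE; apply/asboolP; exists z.
Qed.

Fact coker_pi_surj (y : coker) : coker_pi (repr y) = y.
Proof. exact: reprK. Qed.

Fact coker_piD : {morph coker_pi : x y / x + y}.
Proof. by move=> x y; rewrite /coker_pi !piE. Qed.

Definition coker_scale (a : R) (y : coker) : coker := coker_pi (a *: repr y).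

Fact coker_piZ a x : coker_pi (a *: x) = coker_scale a (coker_pi x).
Proof.
apply/coker_pi_eq; have /coker_pi_eq[z zE] := esym (coker_pi_surj (coker_pi x)).
by exists (a *: z); rewrite linearZ /= zE scalerBr.
Qed.

Fact coker_scaleA a b x : coker_scale a (coker_scale b x) = coker_scale (a * b) x.
Proof. by rewrite -(coker_pi_surj x) -!coker_piZ scalerA. Qed.
Fact coker_scale1 : left_id 1 coker_scale.
Proof. by move=> x; rewrite -(coker_pi_surj x) -coker_piZ scale1r. Qed.
Fact coker_scaleDr : right_distributive coker_scale +%R.
Proof.
move=> a x y; rewrite -(coker_pi_surj x) -(coker_pi_surj y).
by rewrite -coker_piD -!coker_piZ scalerDr coker_piD.
Qed.
Fact coker_scaleDl x : {morph coker_scale^~ x : a b / a + b}.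
Proof.
by move=> a b; rewrite -(coker_pi_surj x) -!coker_piZ scalerDl coker_piD.
Qed.

HB.instance Definition _ := GRing.Zmodule_isLmodule.Build R coker
  coker_scaleA coker_scale1 coker_scaleDr coker_scaleDl.

Fact coker_pi_linear : linear coker_pi.
Proof. by move=> a x y; rewrite coker_piD coker_piZ. Qed.

HB.instance Definition _ :=
  GRing.isLinear.Build R B coker *:%R coker_pi coker_pi_linear.

End Cokernel.

Definition left_noetherian (R : pzRingType) : Prop :=
  forall J : nat -> {pred R^o},
    (forall n, submod_closed (J n)) ->
    (forall n, {subset J n <= J n.+1}) ->
    exists N, forall n, (N <= n)%N -> J n =i J N.

Definition left_gorenstein (R : pzRingType) : Prop :=
  left_noetherian R /\ finite_injdim (C := ModCat R) R^o.

(* Right R-modules are left modules over the converse ring R^c.                *)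
Definition gorenstein_ring (R : pzRingType) : Prop :=
  left_gorenstein R /\ left_gorenstein R^c.

(* Requiring choiceType for the sets of vertices and arrows is no restriction: *)
(* any type T can be replaced by {classic T}.                                  *)
Record quiver := Quiver {
  vertex : choiceType;
  arrow : choiceType;
  src : arrow -> vertex;
  tgt : arrow -> vertex
}.

Arguments src {_} _.
Arguments tgt {_} _.

Record rep (Q : quiver) (R : pzRingType) := Rep {
  rep_obj :> vertex Q -> lmodType R;
  rep_map : forall a : arrow Q, {linear rep_obj (src a) -> rep_obj (tgt a)}
}.

Section RepCategory.
Variables (Q : quiver) (R : pzRingType).

Record rep_hom (X Y : rep Q R) := RepHom {
  rep_hom_val :> forall v, {linear X v -> Y v};
  rep_hom_nat : forall a x,
    rep_hom_val (tgt a) (rep_map X a x) = rep_map Y a (rep_hom_val (src a) x)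
}.

Fact rep_hom_ext (X Y : rep Q R) (f g : rep_hom X Y) :
  (forall v, f v =1 g v) -> f = g.
Proof.
case: f => f fn; case: g => g gn /= fg.
have eq_fg : f = g.
  by apply: functional_extensionality_dep => v; apply/linear_ext/fg.
by subst g; rewrite (Prop_irrelevance fn gn).
Qed.

Definition rep_id (X : rep Q R) : rep_hom X X :=
  RepHom (rep_hom_val := fun v => lin_id (X v)) (fun _ _ => erefl).

Fact rep_comp_nat (X Y Z : rep Q R) (g : rep_hom Y Z) (f : rep_hom X Y) a x :
  lin_comp (g (tgt a)) (f (tgt a)) (rep_map X a x) =
  rep_map Z a (lin_comp (g (src a)) (f (src a)) x).
Proof. by rewrite /= !rep_hom_nat. Qed.

Definition rep_comp (X Y Z : rep Q R) (g : rep_hom Y Z) (f : rep_hom X Y) :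
    rep_hom X Z :=
  RepHom (rep_hom_val := fun v => lin_comp (g v) (f v)) (rep_comp_nat g f).

Fact rep_zero_nat (X Y : rep Q R) a x :
  lin_zero (X (tgt a)) (Y (tgt a)) (rep_map X a x) =
  rep_map Y a (lin_zero (X (src a)) (Y (src a)) x).
Proof. by rewrite /= linear0. Qed.

Definition rep_zero (X Y : rep Q R) : rep_hom X Y :=
  RepHom (rep_hom_val := fun v => lin_zero (X v) (Y v)) (@rep_zero_nat X Y).

Fact rep_compA X Y Z T (h : rep_hom Z T) (g : rep_hom Y Z) (f : rep_hom X Y) :
  rep_comp h (rep_comp g f) = rep_comp (rep_comp h g) f.
Proof. exact: rep_hom_ext. Qed.
Fact rep_comp1 X Y (f : rep_hom X Y) : rep_comp (rep_id Y) f = f.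
Proof. exact: rep_hom_ext. Qed.
Fact rep_compr1 X Y (f : rep_hom X Y) : rep_comp f (rep_id X) = f.
Proof. exact: rep_hom_ext. Qed.
Fact rep_comp0 X Y Z (f : rep_hom X Y) : rep_comp (rep_zero Y Z) f = rep_zero X Z.
Proof. exact: rep_hom_ext. Qed.
Fact rep_compr0 X Y Z (g : rep_hom Y Z) : rep_comp g (rep_zero X Y) = rep_zero X Z.
Proof. by apply: rep_hom_ext => v x; apply: linear0. Qed.

Definition RepCat : category0 :=
  @Category0 (rep Q R) rep_hom rep_id rep_comp rep_zero
    rep_compA rep_comp1 rep_compr1 rep_comp0 rep_compr0.

Definition in_arrow (v : vertex Q) : choiceType := {a : arrow Q | tgt a == v}.

Definition rep_in_map (X : rep Q R) (v : vertex Q) (a : in_arrow v) :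
    {linear X (src (val a)) -> X v} :=
  ecast w {linear X (src (val a)) -> X w} (eqP (valP a)) (rep_map X (val a)).

Definition rep_dsum (X : rep Q R) (v : vertex Q) : lmodType R :=
  dsum (fun a : in_arrow v => X (src (val a))).

Definition rep_fan (X : rep Q R) (v : vertex Q) : {linear rep_dsum X v -> X v} :=
  dsum_map (@rep_in_map X v).

End RepCategory.

Definition sink_projective (Q : quiver) : Prop :=
  forall (R : pzRingType) (X : rep Q R),
    is_projective (C := RepCat Q R) X <->
    (forall v, is_projective (C := ModCat R) (X v)) /\
    (forall v, is_split_mono (C := ModCat R) (rep_fan X v)).

(* Main.v *)
From HB Require Import structures.
From mathcomp Require Import all_boot all_order all_algebra.
From mathcomp Require Import finmap boolp classical_sets functions cardinality fsbigop.
Require Import Defs.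

Set Implicit Arguments.
Unset Strict Implicit.
Unset Printing Implicit Defensive.

(** Write Phi M v for the direct sum of the modules M (src a) over the arrows a
into v, so that f_v, the fan of M at v, is a map from Phi M v to M v.

Both directions rest on the fact that, over a Gorenstein ring R, an exact complex
of projectives automatically stays exact under Hom(-, L) for every projective L,
so that the Gorenstein projective objects are exactly the syzygies of exact
complexes of projectives.
- For modules: direct sums of injective modules are injective over a noetherian
  ring ([dsum_injective], through Baer's criterion), so free modules inherit from
  R a finite injective resolution, and Hom(-, L) is handled by dimension shifting
  along such a resolution ([hom_exact_projective]).
- For representations: if P is a complex of projective representations, then
  0 -> Hom(P, L) -> prod_v Hom(P v, L v) -> prod_a Hom(P (src a), L (tgt a)) -> 0
  is exact; surjectivity on the right says that an extension of P by L splits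
  ([rep_coboundary]). The two products are exact by the case of modules, hence so
  is Hom(P, L) ([rep_hom_exact]).

If M is a syzygy of an exact complex P of projective representations, then M v
is a syzygy of P v. Since the fans of the P i are split monomorphisms, their
cokernels form a complex of projective modules; a diagram chase
([fan_coker_exact]) shows that this complex is exact, that the fan of M is
injective, and that its cokernel is a syzygy.

Conversely, let the fans of M be injective with Gorenstein projective cokernels
C v. A projective resolution continues M to the left ([enough_projectives]). To
continue it to the right, M has to be embedded in a projective representation
whose quotient by M satisfies the same assumption ([fan_gproj_step]). Choose C v
inside a projective module W v with W v / C v Gorenstein projective, and let P be
the representation induced from W, so that the fan of P at v is a split
monomorphism with cokernel W v. A map Phi M v -> Phi P v, given by the maps
already constructed at the sources of the arrows into v, extends to M v because
Ext^1(C v, Phi P v) = 0 ([gproj_extend]), and together with M v -> C v -> W v it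
yields M v -> P v.

This last construction is a recursion along the arrows, so it needs that there is
no infinite path ... -> v2 -> v1 -> v0 ([sink_projective_wf]). Otherwise, the free
abelian groups on the infinite paths ending at each vertex form a nonzero
representation which satisfies the two conditions characterizing projectivity
over a sink projective quiver, and whose fans are bijective because an infinite
path is determined by its last arrow and what precedes it. But a projective
representation with surjective fans vanishes ([rep_projective_fan_surj]). *)

Import GRing.Theory.
Local Open Scope ring_scope.
Local Open Scope classical_set_scope.

(** * Linear maps, submodules and cokernels *)

Section LinearMaps.
Variable R : pzRingType.
Implicit Types A B D K L T : lmodType R.

(** The underlying linear map is kept opaque, so that simplification leaves maps
built from it alone; [to_linearE] is the way to compute with them. *)
Lemma linear_sig A B (f : A -> B) : linear f -> {g : {linear A -> B} | g =1 f}.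
Proof.
move=> hf.
pose g : {linear A -> B} := HB.pack f (GRing.isLinear.Build R A B *:%R f hf).
by exists g.
Qed.
Definition to_linear A B (f : A -> B) (hf : linear f) : {linear A -> B} :=
  sval (linear_sig hf).
Lemma to_linearE A B (f : A -> B) (hf : linear f) : to_linear hf =1 f.
Proof. exact: svalP (linear_sig hf). Qed.

Definition lin_add A B (f g : {linear A -> B}) : {linear A -> B} := f \+ g.
Definition lin_sub A B (f g : {linear A -> B}) : {linear A -> B} := f \- g.

Fact lin_at_linear A (x : A) : linear (fun r : R^o => (r : R) *: x).
Proof. by move=> a r s; rewrite scalerDl scalerA. Qed.
(** Linear maps out of the regular module are the elements of the target: they
turn universal properties into statements about elements. *)
Definition lin_at A (x : A) : {linear R^o -> A} := to_linear (lin_at_linear x).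
Lemma lin_atE A (x : A) r : lin_at x r = (r : R) *: x.
Proof. exact: to_linearE. Qed.

Lemma lin_inj A B (f : {linear A -> B}) :
  (forall x, f x = 0 -> x = 0) -> injective f.
Proof.
move=> f0 x y fxy; apply/eqP; rewrite -subr_eq0; apply/eqP/f0.
by rewrite linearB /= fxy subrr.
Qed.

Lemma lin_factor A B D (p : {linear A -> B}) (h : {linear A -> D}) :
  (forall y, exists x, p x = y) -> (forall x, p x = 0 -> h x = 0) ->
  exists h' : {linear B -> D}, forall x, h' (p x) = h x.
Proof.
move=> /choice[s ps] ker.
have hs x y : p x = p y -> h x = h y.
  move=> pxy; apply/eqP; rewrite -subr_eq0 -linearB; apply/eqP/ker.
  by rewrite linearB /= pxy subrr.
have lin : linear (h \o s).
  move=> a x y /=; rewrite -linearP; apply: hs.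
  by rewrite ps linearP !ps.
by exists (to_linear lin) => x; rewrite to_linearE; apply: hs; rewrite /= ps.
Qed.

Lemma lin_corestrict K A T (k : {linear K -> A}) (h : {linear T -> A}) :
  injective k -> (forall t, exists x, k x = h t) ->
  exists h' : {linear T -> K}, forall t, k (h' t) = h t.
Proof.
move=> inj /choice[s ks].
have lin : linear s by move=> a x y; apply: inj; rewrite linearP !ks linearP.
by exists (to_linear lin) => t; rewrite to_linearE ks.
Qed.

End LinearMaps.

Record submodule (R : pzRingType) (B : lmodType R) := Submodule {
  smod_pred : {pred B};
  smod_closed : submod_closed smod_pred
}.

HB.instance Definition _ (R : pzRingType) (B : lmodType R) (S : submodule B) :=
  GRing.isSubmodClosed.Build R B (smod_pred S) (smod_closed S).

Section Submodules.
Variables (R : pzRingType) (B : lmodType R) (S : submodule B).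

Record smod := SMod { smod_val : B; _ : smod_val \in smod_pred S }.

HB.instance Definition _ := [isSub for smod_val].
HB.instance Definition _ := [Choice of smod by <:].
HB.instance Definition _ := [SubChoice_isSubLmodule of smod by <:].

Definition smod_incl : {linear smod -> B} := val : smod -> B.

Lemma smod_incl_inj : injective smod_incl.
Proof. exact: val_inj. Qed.

Lemma smod_inclP (x : smod) : smod_incl x \in smod_pred S.
Proof. exact: valP. Qed.

Lemma smod_inclE (x : B) : x \in smod_pred S -> exists y, smod_incl y = x.
Proof. by move=> xS; exists (SMod xS). Qed.

End Submodules.

Section Kernel.
Variables (R : pzRingType) (A B : lmodType R) (f : {linear A -> B}).

Definition ker_pred : {pred A} := fun x => f x == 0.
Fact ker_closed : submod_closed ker_pred.
Proof.
split=> [|a x y]; rewrite !unfold_in; first by rewrite linear0.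
by move=> /eqP fx /eqP fy; rewrite linearP fx fy scaler0 addr0.
Qed.
Definition ker := smod (Submodule ker_closed).
Definition ker_incl : {linear ker -> A} := smod_incl (Submodule ker_closed).
HB.instance Definition _ := GRing.Lmodule.on ker.

Lemma ker_incl_inj : injective ker_incl.
Proof. exact: smod_incl_inj. Qed.
Lemma ker_inclK (x : ker) : f (ker_incl x) = 0.
Proof. by apply/eqP; exact: (smod_inclP x). Qed.
Lemma ker_inclE (x : A) : f x = 0 -> exists y, ker_incl y = x.
Proof. by move=> /eqP fx; apply: smod_inclE. Qed.
End Kernel.

Section Cokernel.
Variables (R : pzRingType) (A B : lmodType R) (f : {linear A -> B}).

Definition cproj : {linear B -> coker f} := coker_pi f.

Lemma cproj_surj y : exists x, cproj x = y.
Proof. by exists (repr y); exact: coker_pi_surj. Qed.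

Lemma cproj_eq0 y : cproj y = 0 <-> exists x, f x = y.
Proof.
rewrite -(linear0 cproj).
split=> [/coker_pi_eq[x fx]|[x fx]]; last by apply/coker_pi_eq; exists x; rewrite subr0.
by exists x; rewrite fx subr0.
Qed.

Lemma cprojK x : cproj (f x) = 0.
Proof. by apply/cproj_eq0; exists x. Qed.

End Cokernel.

Section Functoriality.
Variables (R : pzRingType) (A B A' B' : lmodType R).
Variables (f : {linear A -> B}) (f' : {linear A' -> B'}).
Variables (a : {linear A -> A'}) (b : {linear B -> B'}).
Hypothesis sq : forall x, b (f x) = f' (a x).

Lemma coker_map_sig : {h : {linear coker f -> coker f'} |
  forall y, h (cproj f y) = cproj f' (b y)}.
Proof.
apply: cid.
apply: (@lin_factor _ _ _ _ _ (lin_comp (cproj f') b) (cproj_surj (f := f))).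
by move=> _ /cproj_eq0[x <-] /=; apply/cproj_eq0; exists (a x).
Qed.
Definition coker_map := sval coker_map_sig.
Lemma coker_mapE y : coker_map (cproj f y) = cproj f' (b y).
Proof. exact: (svalP coker_map_sig). Qed.

Lemma ker_map_sig : {h : {linear ker f -> ker f'} |
  forall x, ker_incl f' (h x) = a (ker_incl f x)}.
Proof.
apply: cid; apply: (@lin_corestrict _ _ _ _ _ (lin_comp a (ker_incl f))
  (@ker_incl_inj _ _ _ f')).
by move=> x /=; apply: ker_inclE; rewrite -sq ker_inclK linear0.
Qed.
Definition ker_map := sval ker_map_sig.
Lemma ker_mapE x : ker_incl f' (ker_map x) = a (ker_incl f x).
Proof. exact: (svalP ker_map_sig). Qed.

End Functoriality.

(** * Exactness of modules in terms of elements *)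

Section Category0Lemmas.
Variable C : category0.

(** This transports what is visible on the concrete kernels of modules and
representations to any morphism having the universal property of a kernel. *)
Lemma kernel_uniq (K K' A B : C) (g : hom A B) (k : hom K A) (k' : hom K' A) :
  is_kernel g k -> is_kernel g k' ->
  exists (s : hom K K') (t : hom K' K),
    [/\ k' \oc s = k, k \oc t = k', s \oc t = idm K' & t \oc s = idm K].
Proof.
move=> [gk uk] [gk' uk'].
have [s [ks _]] := uk' _ k gk; have [t [kt _]] := uk _ k' gk'.
exists s, t; split=> //.
- have [i [_ iu]] := uk' _ k' gk'.
  by rewrite -[RHS]iu ?compm1 // -(iu (s \oc t)) // compmA ks.
- have [i [_ iu]] := uk _ k gk.
  by rewrite -[RHS]iu ?compm1 // -(iu (t \oc s)) // compmA kt.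
Qed.

Lemma exact_comp0 (A B D : C) (f : hom A B) (g : hom B D) :
  is_exact f g -> g \oc f = zerom A D.
Proof. by move=> [K [k [e [[gk _] _ ->]]]]; rewrite compmA gk comp0m. Qed.

Lemma projective_lift_exact (P A B D : C) (f : hom A B) (g : hom B D) (h : hom P B) :
  is_projective P -> is_exact f g -> g \oc h = zerom P D ->
  exists h' : hom P A, f \oc h' = h.
Proof.
move=> Pp [K [k [e [[_ uk] epi ->]]]] /uk[h1 [kh1 _]].
by have [h2 eh2] := Pp _ _ _ epi h1; exists h2; rewrite -compmA eh2.
Qed.

Lemma projective_retract (P L : C) (i : hom L P) (r : hom P L) :
  is_projective P -> r \oc i = idm L -> is_projective L.
Proof.
move=> Pp ri A B g epi h; have [h' gh'] := Pp _ _ _ epi (h \oc r).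
by exists (h' \oc i); rewrite compmA gh' -compmA ri compm1.
Qed.

End Category0Lemmas.

Section Modules.
Variable R : pzRingType.
Implicit Types A B D E K L P T : lmodType R.

Lemma lin_app A B (f g : {linear A -> B}) : f = g -> forall x, f x = g x.
Proof. by move=> ->. Qed.

Definition exact_at A B D (f : {linear A -> B}) (g : {linear B -> D}) : Prop :=
  (forall x, g (f x) = 0) /\ (forall y, g y = 0 -> exists x, f x = y).

Lemma mod_epiP A B (f : {linear A -> B}) :
  is_epi (C := ModCat R) f <-> forall y, exists x, f x = y.
Proof.
split=> [epi y|surj D g h gh].
  have e : lin_comp (cproj f) f = lin_comp (lin_zero B (coker f)) f.
    by apply: linear_ext => x; exact: cprojK.
  by apply/cproj_eq0; exact: (lin_app (epi (coker f) _ _ e) y).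
by apply: linear_ext => y; have [x <-] := surj y; exact: (lin_app gh x).
Qed.

Lemma mod_monoP A B (f : {linear A -> B}) :
  is_mono (C := ModCat R) f <-> injective f.
Proof.
split=> [mono x y fxy|inj D g h gh].
  have e : lin_comp f (lin_at x) = lin_comp f (lin_at y).
    by apply: linear_ext => r; rewrite /= !lin_atE !linearZ /= fxy.
  have /lin_app/(_ 1) /= := mono R^o _ _ e.
  by rewrite !lin_atE !scale1r.
apply: linear_ext => t; apply: inj.
exact: (lin_app gh t).
Qed.

Lemma ker_is_kernel A B (g : {linear A -> B}) :
  is_kernel (C := ModCat R) g (ker_incl g).
Proof.
split=> [|T h gh]; first by apply: linear_ext => x; exact: ker_inclK.
have [h' hh'] : exists h' : {linear T -> ker g}, forall t, ker_incl g (h' t) = h t.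
  apply: lin_corestrict (@ker_incl_inj _ _ _ g) _ => t; apply: ker_inclE.
  exact: (lin_app gh t).
exists h'; split=> [|h2 eh2]; first exact: linear_ext.
apply: linear_ext => t; apply: (@ker_incl_inj _ _ _ g); rewrite hh'.
by rewrite -eh2.
Qed.

Lemma mod_kernelP A B K (g : {linear A -> B}) (k : {linear K -> A}) :
  is_kernel (C := ModCat R) g k <-> injective k /\ exact_at k g.
Proof.
split=> [kk|[inj [gk kg]]].
  have [s [t [ks kt st ts]]] := kernel_uniq kk (ker_is_kernel g).
  have ksE (x : K) : ker_incl g ((s : {linear _ -> _}) x) = k x.
    exact: (lin_app ks x).
  have ktE x : k ((t : {linear _ -> _}) x) = ker_incl g x.
    exact: (lin_app kt x).
  have tsE (x : K) : (t : {linear _ -> _}) ((s : {linear _ -> _}) x) = x.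
    exact: (lin_app ts x).
  split; first by move=> x y; rewrite -!ksE => /ker_incl_inj e; rewrite -(tsE x) e tsE.
  split=> [x|y /ker_inclE[x <-]]; first by rewrite -ksE ker_inclK.
  by exists ((t : {linear _ -> _}) x); rewrite ktE.
split=> [|T h gh]; first exact: linear_ext.
have [h' hh'] : exists h' : {linear T -> K}, forall t, k (h' t) = h t.
  apply: lin_corestrict inj _ => t; apply: kg.
  exact: (lin_app gh t).
exists h'; split=> [|h2 eh2]; first exact: linear_ext.
by apply: linear_ext => t; apply: inj; rewrite hh' -eh2.
Qed.

(** The kernel through which an exact pair factors is unique up to isomorphism, so
it may be taken to be the submodule of elements killed by the second map. *)
Lemma mod_exactP A B D (f : {linear A -> B}) (g : {linear B -> D}) :
  is_exact (C := ModCat R) f g <-> exact_at f g.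
Proof.
split=> [[K [k [e [/mod_kernelP[_ [gk kg]] /mod_epiP surj ->]]]]|[gf fg]].
  split=> [x|y /kg[z <-]]; first exact: gk.
  by have [x <-] := surj z; exists x.
have [e ee] : exists e : {linear A -> ker g}, forall x, ker_incl g (e x) = f x.
  by apply: lin_corestrict (@ker_incl_inj _ _ _ g) _ => x; apply: ker_inclE.
exists (ker g : lmodType R), (ker_incl g), e; split; first exact: ker_is_kernel.
  apply/mod_epiP => z; have [x fx] := fg _ (ker_inclK z).
  by exists x; apply: (@ker_incl_inj _ _ _ g); rewrite ee.
by apply: linear_ext => x; exact: esym (ee x).
Qed.

(** Exactness makes coker f a submodule of D, and h descends to coker f. *)
Lemma mod_injective_extend E A B D (f : {linear A -> B}) (g : {linear B -> D})
    (h : {linear B -> E}) :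
  is_injective (C := ModCat R) E -> exact_at f g -> (forall x, h (f x) = 0) ->
  exists h' : {linear D -> E}, forall y, h' (g y) = h y.
Proof.
move=> Ei [gf fg] hf; have surj := @cproj_surj _ _ _ f.
have [_ /cproj_eq0[x <-]|g1 g1E] := lin_factor (h := g) surj; first exact: gf.
have [_ /cproj_eq0[x <-]|h1 h1E] := lin_factor (h := h) surj; first exact: hf.
have mono : is_mono (C := ModCat R) g1.
  apply/mod_monoP/lin_inj => y; have [x <-] := surj y; rewrite g1E => /fg xf.
  exact/cproj_eq0.
have [h' h'g] := Ei _ _ _ mono h1.
exists h' => y; rewrite -g1E -h1E; exact: (lin_app h'g (cproj f y)).
Qed.

End Modules.

(** * Direct sums and free modules *)

Section DirectSumTheory.
Variables (R : pzRingType) (I : choiceType).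
Implicit Types (M N K : I -> lmodType R) (L : lmodType R).

Lemma dsum_eqP M (x y : dsum M) :
  (forall i, (x : lprod M) i = (y : lprod M) i) -> x = y.
Proof. by move=> xy; apply/val_inj/functional_extensionality_dep. Qed.

Lemma dsum_supp M (x : dsum M) : finite_set (lsupp x).
Proof. by apply/asboolP; case: x. Qed.

Lemma dsum_of M (f : forall i, M i) : finite_set [set i | f i != 0] ->
  exists x : dsum M, forall i, (x : lprod M) i = f i.
Proof.
move=> ff; have fP : (f : lprod M) \in @finsupp_pred R I M by apply/asboolP.
by exists (DSum fP).
Qed.

Fact dsum_pr_linear M i : linear (fun x : dsum M => (x : lprod M) i).
Proof. by []. Qed.
Definition dsum_pr M i : {linear dsum M -> M i} := to_linear (dsum_pr_linear i).

Lemma dsum_prE M i (x : dsum M) : dsum_pr M i x = (x : lprod M) i.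
Proof. exact: to_linearE. Qed.

(** The coordinates live in modules depending on the index, whence the transport
along the equality of indices. *)
Definition single M i (x : M i) : lprod M :=
  fun j => if pselect (i = j) is left e then eq_rect i M x j e else 0.

Lemma single_id M i (x : M i) : single x i = x.
Proof.
rewrite /single; case: pselect => // e.
by rewrite (Prop_irrelevance e erefl).
Qed.

Lemma single_neq M i (x : M i) j : i <> j -> single x j = 0.
Proof. by rewrite /single; case: pselect. Qed.

Fact single_finsupp M i (x : M i) : single x \in @finsupp_pred R I M.
Proof.
apply/asboolP; apply: (sub_finite_set _ (finite_set1 i)) => j /=.
rewrite /lsupp /=; have [//|ij] := pselect (j = i).
by rewrite single_neq ?eqxx // => e; apply: ij.
Qed.

Fact dsum_in_linear M i : linear (fun x : M i => DSum (single_finsupp x)).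
Proof.
move=> a x y; apply: dsum_eqP => j.
rewrite -[RHS]/(a *: single x j + single y j) /=.
have [ij|ij] := pselect (i = j); last by rewrite !single_neq // scaler0 addr0.
by subst j; rewrite !single_id.
Qed.
Definition dsum_in M i : {linear M i -> dsum M} := to_linear (@dsum_in_linear M i).

Lemma dsum_inE M i (x : M i) j : dsum_pr M j (dsum_in M i x) = single x j.
Proof. by rewrite dsum_prE /dsum_in to_linearE. Qed.

Lemma dsum_pr_in M i (x : M i) : dsum_pr M i (dsum_in M i x) = x.
Proof. by rewrite dsum_inE single_id. Qed.

Lemma dsum_pr_in_neq M i j (x : M i) : i <> j -> dsum_pr M j (dsum_in M i x) = 0.
Proof. by move=> ij; rewrite dsum_inE single_neq. Qed.

Lemma dsum_decomp M (x : dsum M) :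
  x = \sum_(i <- fset_set (lsupp x)) dsum_in M i (dsum_pr M i x).
Proof.
apply: dsum_eqP => j.
rewrite -!dsum_prE linear_sum /=.
have supp_fin := dsum_supp x.
have [jx|jx] := boolP (j \in fset_set (lsupp x)).
  rewrite (big_fsetD1 j) //= big_seq big1 ?addr0; first by rewrite dsum_pr_in.
  by move=> i; rewrite !inE => /andP[/eqP ij _]; rewrite dsum_pr_in_neq.
rewrite big_seq big1; last first.
  move=> i ix; rewrite dsum_pr_in_neq // => ij; move: jx; by rewrite -ij ix.
move: jx; rewrite in_fset_set // notin_setE => /negP.
by rewrite negbK -dsum_prE => /eqP.
Qed.

(** Elements of a direct sum are finite sums of elements of the summands; all later
computations in direct sums go through this principle and [dsum_lin_in]. *)
Lemma dsum_ext M L (f g : {linear dsum M -> L}) :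
  (forall i x, f (dsum_in M i x) = g (dsum_in M i x)) -> f =1 g.
Proof.
move=> fg x; rewrite (dsum_decomp x) !linear_sum.
by apply: eq_bigr => i _; rewrite fg.
Qed.

Definition dsum_lin M L (f : forall i, {linear M i -> L}) : {linear dsum M -> L} :=
  dsum_map f.

Lemma dsum_lin_in M L (f : forall i, {linear M i -> L}) i (x : M i) :
  dsum_lin f (dsum_in M i x) = f i x.
Proof.
rewrite -[LHS]/(dsum_map f (dsum_in M i x)).
rewrite /dsum_map (@fsbigTE _ _ _ _ [fset i]%fset) => [|j]; last first.
  rewrite inE => /eqP ji; rewrite -dsum_prE dsum_pr_in_neq ?linear0 // => ij.
  by apply: ji.
by rewrite big_seq_fset1 -dsum_prE dsum_pr_in.
Qed.

Definition dsum_fun M N (f : forall i, {linear M i -> N i}) :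
  {linear dsum M -> dsum N} :=
  dsum_lin (fun i => lin_comp (dsum_in N i) (f i)).

Lemma dsum_fun_in M N (f : forall i, {linear M i -> N i}) i (x : M i) :
  dsum_fun f (dsum_in M i x) = dsum_in N i (f i x).
Proof. by rewrite /dsum_fun dsum_lin_in. Qed.

Lemma dsum_pr_fun M N (f : forall i, {linear M i -> N i}) i (x : dsum M) :
  dsum_pr N i (dsum_fun f x) = f i (dsum_pr M i x).
Proof.
apply: (@dsum_ext M (N i) (lin_comp (dsum_pr N i) (dsum_fun f))
                 (lin_comp (f i) (dsum_pr M i))) => j y /=.
rewrite dsum_fun_in; have [ji|ji] := pselect (j = i).
  by subst j; rewrite !dsum_pr_in.
by rewrite !dsum_pr_in_neq // linear0.
Qed.

(** Preimages are chosen coordinatewise, with 0 above 0 so that the support stays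
finite. *)
Lemma dsum_fun_lift M N (f : forall i, {linear M i -> N i}) (y : dsum N) :
  (forall i, exists x, f i x = dsum_pr N i y) -> exists x, dsum_fun f x = y.
Proof.
move=> fy.
have hs i : exists x, f i x = dsum_pr N i y /\ (dsum_pr N i y = 0 -> x = 0).
  have [y0|/eqP y0] := eqVneq (dsum_pr N i y) 0; last by have [x fx] := fy i; exists x.
  by exists 0; rewrite linear0 y0.
pose s i := projT1 (cid (hs i)).
have sP i : f i (s i) = dsum_pr N i y /\ (dsum_pr N i y = 0 -> s i = 0).
  by rewrite /s; case: cid.
have [x xs] : exists x : dsum M, forall i, (x : lprod M) i = s i.
  apply: dsum_of; apply: sub_finite_set (dsum_supp y) => i.
  by rewrite /lsupp /= -dsum_prE; apply: contra_neq => /(proj2 (sP i)).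
exists x; apply: dsum_eqP => i.
by rewrite -!dsum_prE dsum_pr_fun dsum_prE xs (proj1 (sP i)) dsum_prE.
Qed.

Lemma dsum_fun_exact M N K (f : forall i, {linear M i -> N i})
    (g : forall i, {linear N i -> K i}) :
  (forall i, exact_at (f i) (g i)) ->
  exact_at (dsum_fun f) (dsum_fun g).
Proof.
move=> fg; split=> [x|y gy].
  apply: dsum_eqP => i; rewrite -!dsum_prE linear0 !dsum_pr_fun.
  by case: (fg i) => -> _.
apply: dsum_fun_lift => i; apply: (proj2 (fg i)).
by rewrite -dsum_pr_fun gy linear0.
Qed.

Lemma dsum_fun_inj M N (f : forall i, {linear M i -> N i}) :
  (forall i, injective (f i)) -> injective (dsum_fun f).
Proof.
move=> inj x y fxy; apply: dsum_eqP => i; apply: inj.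
by rewrite -!dsum_prE -!dsum_pr_fun fxy.
Qed.

Lemma dsum_projective M : (forall i, is_projective (C := ModCat R) (M i)) ->
  is_projective (C := ModCat R) (dsum M).
Proof.
move=> Mp A B g epi h.
have hs i : exists k : {linear M i -> A}, forall x, g (k x) = h (dsum_in M i x).
  have [k gk] := Mp i A B g epi (lin_comp h (dsum_in M i)).
  by exists k => x; exact: (lin_app gk x).
exists (dsum_lin (fun i => projT1 (cid (hs i)))).
apply: linear_ext; apply: dsum_ext => i x /=.
by rewrite dsum_lin_in; case: cid => k /= ->.
Qed.

End DirectSumTheory.

Section Free.
Variable R : pzRingType.
Implicit Types (L : lmodType R).

Lemma regular_projective : is_projective (C := ModCat R) R^o.
Proof.
move=> A B g /mod_epiP surj h; have [x gx] := surj (h (1 : R^o)).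
exists (lin_at x); apply: linear_ext => r /=.
rewrite lin_atE linearZ /= gx -linearZ /=; congr (h _); exact: mulr1.
Qed.

Definition free_mod (I : choiceType) : lmodType R :=
  dsum (fun _ : I => (R^o : lmodType R)).

Lemma free_projective I : is_projective (C := ModCat R) (free_mod I).
Proof. by apply: dsum_projective => _; exact: regular_projective. Qed.

Definition free_cover L : {linear free_mod L -> L} := dsum_lin (fun x : L => lin_at x).

Lemma free_cover_surj L (x : L) : exists y, free_cover L y = x.
Proof.
exists (dsum_in (fun _ : L => (R^o : lmodType R)) x (1 : R^o)).
by rewrite /free_cover dsum_lin_in lin_atE scale1r.
Qed.

Lemma projective_retract_free L : is_projective (C := ModCat R) L ->
  exists i : {linear L -> free_mod L}, forall x, free_cover L (i x) = x.
Proof.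
have epi : is_epi (C := ModCat R) (free_cover L) by apply/mod_epiP/free_cover_surj.
move=> /(_ _ _ _ epi (lin_id L))[i ri].
by exists i => x; exact: (lin_app ri x).
Qed.
End Free.

(** * Injective modules over a noetherian ring *)

Section Baer.
Variable R : pzRingType.
Implicit Types A B E : lmodType R.

(** Extension of maps from left ideals to the whole ring, a map from the ring to E
being multiplication of an element of E. *)
Definition baer E : Prop :=
  forall (J : submodule R^o) (h : {linear smod J -> E}),
    exists e : E, forall x, h x = (smod_incl J x : R) *: e.

Lemma injective_baer E : is_injective (C := ModCat R) E -> baer E.
Proof.
move=> Ei J h.
have mono : is_mono (C := ModCat R) (smod_incl J) by apply/mod_monoP/smod_incl_inj.
have [h' h'E] := Ei _ _ _ mono h.
exists ((h' : {linear R^o -> E}) (1 : R^o)) => x.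
rewrite -linearZ /= -(lin_app h'E x) /=; congr (_ _); exact: esym (mulr1 _).
Qed.

Section Extension.
Variables (E A B : lmodType R) (g : {linear A -> B}) (h : {linear A -> E}).
Hypotheses (baerE : baer E) (injg : injective g).

(** Graphs of linear maps to E from submodules of B that extend h along g. The last
clause, stability under adding points of the graph of h, replaces containment of
that graph: the two agree on nonempty sets, and the empty set is then a partial
extension too, as Zorn's lemma on unions of possibly empty chains demands. *)
Definition partial_ext (G : set (B * E)) : Prop :=
  [/\ forall a p q, G p -> G q -> G (a *: p + q),
      forall e, G (0, e) -> e = 0 &
      forall p x, G p -> G (p + (g x, h x))].

Lemma partial_ext_chain (F : set (set (B * E))) :
  F `<=` partial_ext -> total_on F subset -> partial_ext (\bigcup_(X in F) X).
Proof.
move=> FP tot; split=> [a p q [X FX Xp] [Y FY Yq]|e [X FX]|p x [X FX Xp]].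
- have [XY|YX] := tot _ _ FX FY.
    by exists Y => //; case: (FP _ FY) => cl _ _; apply: cl => //; exact: XY.
  by exists X => //; case: (FP _ FX) => cl _ _; apply: cl => //; exact: YX.
- by case: (FP _ FX) => _ + _; exact.
- by exists X => //; case: (FP _ FX) => _ _; exact.
Qed.

Lemma partial_ext_base : partial_ext [set p | exists x, p = (g x, h x)].
Proof.
split=> [a _ _ [x ->] [y ->]|e [x [gx ->]]|_ y [x ->]].
- by exists (a *: x + y); rewrite !linearP.
- have -> : x = 0 by apply: injg; rewrite linear0 -gx.
  by rewrite linear0.
- by exists (x + y); rewrite !linearD.
Qed.

Section Adjoin.
Variables (G : set (B * E)) (b : B).
Hypotheses (GP : partial_ext G) (G0 : G 0).

Definition conductor_pred : {pred R^o} := fun r => `[< exists e, G ((r : R) *: b, e) >].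

Lemma conductor_closed : submod_closed conductor_pred.
Proof.
case: GP => cl _ _; split=> [|a x y /asboolP[e Gx] /asboolP[e' Gy]]; apply/asboolP.
  by exists 0; rewrite scale0r.
exists (a *: e + e'); have := cl a _ _ Gx Gy.
by rewrite -[(a *: x + y : R^o)]/(a * x + y) scalerDl -scalerA.
Qed.

Definition conductor := Submodule conductor_closed.

Lemma partial_ext_uniq y e e' : G (y, e) -> G (y, e') -> e = e'.
Proof.
case: GP => cl fn _ Ge Ge'; apply/eqP; rewrite -subr_eq0; apply/eqP/fn.
have := cl (-1) _ _ Ge' Ge; rewrite !scaleN1r addrC.
by rewrite -[(y, e) - (y, e')]/(y - y, e - e') subrr.
Qed.

(** The values forced on the multiples of b in the domain form a linear map on the
conductor; Baer's condition says that they come from a single value at b. *)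
Lemma adjoin_value : exists e0, forall r e, G (r *: b, e) -> e = r *: e0.
Proof.
have /choice[s sG] (x : smod conductor) :
    exists e, G ((smod_incl conductor x : R) *: b, e).
  by have /asboolP := smod_inclP x.
have lin : linear s.
  move=> a x y; apply: (partial_ext_uniq (sG _)).
  rewrite linearP /= -[(a *: _ + _ : R^o)]/(a * _ + _) scalerDl -scalerA.
  by case: GP => cl _ _; exact: (cl a _ _ (sG x) (sG y)).
have [e0 e0P] := baerE (to_linear lin); exists e0 => r e Gr.
have /smod_inclE[x xr] : (r : R^o) \in smod_pred conductor by apply/asboolP; exists e.
have := e0P x; rewrite to_linearE xr => <-.
by apply: (@partial_ext_uniq (r *: b)) => //; have := sG x; rewrite xr.
Qed.

(** Hence a maximal partial extension is defined everywhere. *)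
Lemma adjoin : exists G', [/\ partial_ext G', G `<=` G' & exists e, G' (b, e)].
Proof.
have [e0 e0P] := adjoin_value; case: (GP) => cl fn st.
exists [set p | exists q (r : R), G q /\ p = q + r *: (b, e0)]; split.
- split=> [a _ _ [p [r [Gp ->]]] [q [s [Gq ->]]]|e|_ x [q [r [Gq ->]]]].
  + exists (a *: p + q), (a * r + s); split; first exact: cl.
    by rewrite scalerDr scalerDl addrACA scalerA.
  + move=> [[y e'] [r [Gq [/esym/eqP ye ->]]]].
    rewrite /= addr_eq0 in ye; move/eqP: ye => ye.
    have /e0P -> : G (- r *: b, e') by rewrite scaleNr -ye.
    by rewrite scaleNr addNr.
  + by exists (q + (g x, h x)), r; split; [exact: st|rewrite addrAC].
- by move=> p Gp; exists p, 0; rewrite scale0r addr0.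
- by exists e0, 0, 1; rewrite scale1r add0r.
Qed.
End Adjoin.

Lemma baer_extend : exists h' : {linear B -> E}, forall x, h' (g x) = h x.
Proof.
have [G [GP Gmax]] := Zorn_bigcup partial_ext_chain.
have [cl fn st] := GP.
have [p Gp] : exists p, G p.
  apply: contrapT => /forallNP GN; apply: (Gmax _ _ partial_ext_base).
  split=> [p /GN//|/(_ 0) G0]; apply: (GN 0); apply: G0.
  by exists 0; rewrite !linear0.
have G0 : G 0 by have := cl (-1) p p Gp Gp; rewrite scaleN1r addNr.
have /choice[s sG] y : exists e, G (y, e).
  have [G' [G'P GG' [e Ge]]] := adjoin y GP G0.
  exists e; apply: contrapT => nG; apply: (Gmax G') => //.
  by split=> // G'G; apply/nG/G'G.
have lin : linear s.
  by move=> a x y; apply: (partial_ext_uniq GP (sG _)); exact: (cl a _ _ (sG x) (sG y)).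
exists (to_linear lin) => x; rewrite to_linearE; apply: (partial_ext_uniq GP (sG _)).
by have := st _ x G0; rewrite add0r.
Qed.
End Extension.

Lemma baer_injective E : baer E -> is_injective (C := ModCat R) E.
Proof.
move=> bE A B g /mod_monoP injg h; have [h' h'g] := baer_extend h bE injg.
by exists h'; apply: linear_ext => x; exact: h'g.
Qed.

(** If no finite set of indices supported the image of J, one could pick elements of
J one after the other, each time leaving the finite set of indices seen so far.
The submodules of J supported on these growing sets would form a strictly
ascending chain. *)
Lemma noetherian_finite_support (I : choiceType) (N : I -> lmodType R)
    (J : submodule R^o) (h : {linear smod J -> dsum N}) :
  left_noetherian R ->
  exists F : set I, finite_set F /\
    forall x i, dsum_pr N i (h x) != 0 -> F i.
Proof.
move=> noeth; apply: contrapT => nF.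
have /choice[next nextP] (F : set I) : exists x, finite_set F ->
    exists2 i, dsum_pr N i (h x) != 0 & ~ F i.
  have [fF|] := pselect (finite_set F); last by exists 0.
  apply: contrapT => /forallNP nx; apply: nF; exists F; split=> // x i hi.
  by apply: contrapT => Fi; apply: (nx x) => _; exists i.
(* Fs n is the set of indices met after n choices, K n the part of J that it supports. *)
pose Fs n := iter n (fun F => F `|` lsupp (h (next F))) set0.
have fin n : finite_set (Fs n).
  by elim: n => //= n IH; rewrite finite_setU; split=> //; exact: dsum_supp.
pose K n : {pred R^o} := fun r => `[< exists2 x, smod_incl J x = r &
  forall i, dsum_pr N i (h x) != 0 -> Fs n i >].
have Kcl n : submod_closed (K n).
  split=> [|a _ _ /asboolP[x <- xF] /asboolP[y <- yF]]; apply/asboolP.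
    by exists 0 => [|i]; rewrite !linear0 ?eqxx.
  exists (a *: x + y) => [|i]; first by rewrite linearP.
  have [/eqP|nz _] := boolP (dsum_pr N i (h y) == 0); last exact: yF.
  rewrite !linearP => -> nz; apply: xF; apply: contraNneq nz => ->.
  by rewrite scaler0 addr0.
have Kinc n : {subset K n <= K n.+1}.
  by move=> r /asboolP[x xr xF]; apply/asboolP; exists x => // i /xF; left.
have [m /(_ m.+1 (leqnSn m)) Km] := noeth K Kcl Kinc.
have : smod_incl J (next (Fs m)) \in K m.
  rewrite -Km; apply/asboolP; exists (next (Fs m)) => // i nz /=.
  by right; rewrite /lsupp /= -dsum_prE.
move=> /asboolP[x /smod_incl_inj-> xF].
by have [i /xF] := nextP _ (fin m).
Qed.

(** By Baer's criterion: a map from a left ideal into the sum has finite support F,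
and only the finitely many coordinates in F have to be extended to R. *)
Lemma dsum_injective (I : choiceType) (N : I -> lmodType R) :
  left_noetherian R -> (forall i, is_injective (C := ModCat R) (N i)) ->
  is_injective (C := ModCat R) (dsum N).
Proof.
move=> noeth Ni; apply: baer_injective => J h.
have [F [fF hF]] := noetherian_finite_support h noeth.
have he i : exists e, forall x, dsum_pr N i (h x) = (smod_incl J x : R) *: e.
  exact: (injective_baer (Ni i) (lin_comp (dsum_pr N i) h)).
pose s i : N i := if `[< F i >] then projT1 (cid (he i)) else 0.
have [e eE] : exists e : dsum N, forall i, (e : lprod N) i = s i.
  apply: dsum_of; apply: sub_finite_set fF => i /=.
  by apply: contraNP => nF; rewrite /s asboolF.
exists e => x; apply: dsum_eqP => i; rewrite -!dsum_prE linearZ /= !dsum_prE eE.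
have [Fi|nF] := pselect (F i).
  by rewrite /s asboolT //; case: cid => e' /= <-; rewrite dsum_prE.
rewrite /s asboolF // scaler0; apply/eqP; apply: contrapT => /negP nz.
by apply/nF/(hF x); rewrite dsum_prE.
Qed.

End Baer.

(** * Total acyclicity of exact complexes of projective modules *)

Section HomExact.
Variable R : pzRingType.

(** A direct sum of copies of a finite injective resolution of R. *)
Lemma free_finite_injdim (I : choiceType) :
  left_gorenstein R -> finite_injdim (C := ModCat R) (free_mod R I).
Proof.
move=> [noeth [n [E [eps [d [Ei E0 /mod_monoP mono /mod_exactP ex0 ex]]]]]].
exists n, (fun k => dsum (fun _ : I => E k) : lmodType R), (dsum_fun (fun _ => eps)),
  (fun k => dsum_fun (fun _ : I => (d k : {linear _ -> _}))).
split.
- by move=> k; apply: dsum_injective.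
- move=> k /E0 z; apply: linear_ext => x; apply: dsum_eqP => i.
  exact: (lin_app z _).
- by apply/mod_monoP/dsum_fun_inj.
- by apply/mod_exactP/dsum_fun_exact.
- by move=> k; apply/mod_exactP/dsum_fun_exact => _; apply/mod_exactP/ex.
Qed.

Variables (P : int -> lmodType R) (d : forall i, {linear P i -> P (i + 1)}).
Hypothesis Pp : forall i, is_projective (C := ModCat R) (P i).
Hypothesis ex : forall i, is_exact (C := ModCat R) (d i) (d (i + 1)).

(** Exactness of Hom(P, L) at the spot i + 1, the vanishing of composites being
clear. *)
Definition hom_exact (L : lmodType R) : Prop :=
  forall i (u : {linear P (i + 1) -> L}), (forall x, u (d i x) = 0) ->
  exists w : {linear P (i + 1 + 1) -> L}, forall x, w (d (i + 1) x) = u x.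

(** Hom(P, Z) is exact for each cocycle module Z = ker (e k) of the resolution; maps
into Z are written as maps into E k killed by e k. Induction is downwards on k:
beyond n the modules vanish, and exactness for ker (e k.+1) passes to ker (e k)
since Hom(P, E k) is exact, E k being injective, and maps from the projective
P i lift along e k. *)
Lemma hom_exact_resolution (n : nat) (E : nat -> lmodType R)
    (e : forall k, {linear E k -> E k.+1}) :
  (forall k, is_injective (C := ModCat R) (E k)) ->
  (forall k, (n < k)%N -> is_zero_obj (C := ModCat R) (E k)) ->
  (forall k, is_exact (C := ModCat R) (e k) (e k.+1)) ->
  forall k i (u : {linear P (i + 1) -> E k}),
    (forall x, e k (u x) = 0) -> (forall x, u (d i x) = 0) ->
    exists w : {linear P (i + 1 + 1) -> E k},
      (forall x, e k (w x) = 0) /\ forall x, w (d (i + 1) x) = u x.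
Proof.
move=> Ei E0 eex k.
have [j] : exists j, (n < k + j)%N by exists n.+1; rewrite addnS ltnS leq_addl.
elim: j k => [|j IH] k nk i u eu ud.
  rewrite addn0 in nk.
  exists (lin_zero _ _); split=> x; first exact: linear0.
  exact: esym (lin_app (E0 _ nk) (u x)).
have [w0 w0E] := mod_injective_extend (Ei k) ((mod_exactP _ _).1 (ex i)) ud.
have [w1 [ew1 w1E]] : exists w : {linear P (i + 1 + 1 + 1) -> E k.+1},
    (forall x, e k.+1 (w x) = 0) /\ forall x, w (d (i + 1 + 1) x) = e k (w0 x).
  apply: (IH k.+1 _ (i + 1) (lin_comp (e k) w0)) => [|x|x].
  - by rewrite addSnnS.
  - by case/mod_exactP: (eex k) => + _; apply.
  - by rewrite /= w0E eu.
have [w2 w2E] := projective_lift_exact (@Pp (i + 1 + 1 + 1)) (eex k)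
  (linear_ext (f := lin_comp (e k.+1) w1) (g := lin_zero _ _) ew1).
have w2a x : e k ((w2 : {linear _ -> _}) x) = w1 x := lin_app w2E x.
exists (lin_sub w0 (lin_comp w2 (d (i + 1 + 1)))); split=> x /=.
  by rewrite linearB /= w2a w1E subrr.
rewrite w0E; case/mod_exactP: (ex (i + 1)) => -> _.
by rewrite linear0 subr0.
Qed.

Lemma hom_exact_injdim (L : lmodType R) :
  finite_injdim (C := ModCat R) L -> hom_exact L.
Proof.
move=> [n [E [eps [e [Ei E0 /mod_monoP mono /mod_exactP[ee ex0] eex]]]]] i u ud.
have [w [ew wE]] := hom_exact_resolution Ei E0 eex (u := lin_comp eps u)
  (fun x => ee (u x)) (fun x => etrans (congr1 eps (ud x)) (linear0 eps)).
have [z zE] : exists z : {linear P (i + 1 + 1) -> L}, forall x, eps (z x) = w x.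
  by apply: lin_corestrict mono _ => t; apply: ex0.
by exists z => x; apply: mono; rewrite zE wE.
Qed.

(** A projective module is a retract of a free one. *)
Lemma hom_exact_projective (L : lmodType R) :
  left_gorenstein R -> is_projective (C := ModCat R) L -> hom_exact L.
Proof.
move=> gorR /projective_retract_free[s rs] i u ud.
have [x|w wE] := hom_exact_injdim (free_finite_injdim L gorR) (u := lin_comp s u).
  by rewrite /= ud linear0.
exists (lin_comp (free_cover L) w) => x /=.
by rewrite wE /= rs.
Qed.

End HomExact.

(** By [hom_exact_projective], the condition on Hom(-, L) in the definition of
Gorenstein projective modules is automatic. *)
Lemma mod_gproj (R : pzRingType) (M : lmodType R)
    (P : int -> lmodType R) (d : forall i, {linear P i -> P (i + 1)})
    (k : {linear M -> P 0}) :
  left_gorenstein R ->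
  (forall i, is_projective (C := ModCat R) (P i)) ->
  (forall i, is_exact (C := ModCat R) (d i) (d (i + 1))) ->
  is_kernel (C := ModCat R) (d 0) k ->
  is_gproj (C := ModCat R) M.
Proof.
move=> gorR Pp ex kk; exists P, d, k; split=> // L Lp i u; split=> [ud|[w ->]].
  have [x|w wE] := hom_exact_projective Pp ex gorR Lp (i := i) (u := u).
    exact: (lin_app ud x).
  by exists w; apply: linear_ext => x; exact: esym (wE x).
by rewrite -compmA (exact_comp0 (ex i)) compm0.
Qed.

(** * Exactness of representations in terms of elements *)

Section RepCategoryTheory.
Variables (Q : quiver) (R : pzRingType).
Implicit Types X Y Z K T : rep Q R.

Lemma rep_app X Y (f g : rep_hom X Y) : f = g -> forall v x, f v x = g v x.
Proof. by move=> ->. Qed.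

Section KerCoker.
Variables (X Y : rep Q R) (f : rep_hom X Y).

Fact rep_hom_sq a x : rep_map Y a (f (src a) x) = f (tgt a) (rep_map X a x).
Proof. by rewrite rep_hom_nat. Qed.

Definition rep_ker : rep Q R :=
  Rep (rep_obj := fun v => ker (f v)) (fun a => ker_map (@rep_hom_sq a)).
Definition rep_ker_incl : rep_hom rep_ker X :=
  RepHom (X := rep_ker) (rep_hom_val := fun v => ker_incl (f v))
    (fun a x => ker_mapE (@rep_hom_sq a) x).

Definition rep_coker : rep Q R :=
  Rep (rep_obj := fun v => coker (f v)) (fun a => coker_map (@rep_hom_sq a)).
Definition rep_cproj : rep_hom Y rep_coker :=
  RepHom (Y := rep_coker) (rep_hom_val := fun v => cproj (f v))
    (fun a y => esym (coker_mapE (@rep_hom_sq a) y)).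

Lemma rep_epiP : is_epi (C := RepCat Q R) f <-> forall v y, exists x, f v x = y.
Proof.
split=> [epi v y|surj Z g h gh].
  have e : rep_comp rep_cproj f = rep_comp (rep_zero Y rep_coker) f.
    by apply: rep_hom_ext => w x /=; exact: cprojK.
  by have /rep_app/(_ v y) /cproj_eq0 := epi rep_coker _ _ e.
by apply: rep_hom_ext => v y; have [x <-] := surj v y; exact: (rep_app gh x).
Qed.

(** The lifts at the vertices are compatible with the arrows because k is injective. *)
Lemma rep_corestrict K (k : rep_hom K X) T (h : rep_hom T X) :
  (forall v, injective (k v)) -> (forall v t, exists x, k v x = h v t) ->
  exists h' : rep_hom T K, forall v t, k v (h' v t) = h v t.
Proof.
move=> inj ex.
have hs v : exists h' : {linear T v -> K v}, forall t, k v (h' t) = h v t.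
  exact: lin_corestrict (inj v) (ex v).
pose s v := projT1 (cid (hs v)).
have sE v t : k v (s v t) = h v t by rewrite /s; case: cid.
have nat a t : s (tgt a) (rep_map T a t) = rep_map K a (s (src a) t).
  by apply: inj; rewrite sE !rep_hom_nat sE.
by exists (RepHom nat).
Qed.

Lemma rep_ker_is_kernel : is_kernel (C := RepCat Q R) f rep_ker_incl.
Proof.
split=> [|T h fh]; first by apply: rep_hom_ext => v x; exact: ker_inclK.
have inj v : injective (rep_ker_incl v) by exact: ker_incl_inj.
have [v t|h' h'E] := rep_corestrict (h := h) inj.
  by apply: ker_inclE; exact: (rep_app fh t).
exists h'; split=> [|h2 h2E]; first exact: rep_hom_ext.
apply: rep_hom_ext => v t; apply: inj; rewrite h'E.
by rewrite -h2E.
Qed.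

Lemma rep_kernelP K (k : rep_hom K X) :
  is_kernel (C := RepCat Q R) f k <->
  (forall v, injective (k v)) /\ (forall v, exact_at (k v) (f v)).
Proof.
split=> [kk|[inj kf]].
  have [s [t [ks kt st ts]]] := kernel_uniq kk rep_ker_is_kernel.
  have ksE v (x : K v) : ker_incl (f v) ((s : rep_hom _ _) v x) = k v x := rep_app ks x.
  have ktE v x : k v ((t : rep_hom _ _) v x) = ker_incl (f v) x := rep_app kt x.
  have tsE v (x : K v) : (t : rep_hom _ _) v ((s : rep_hom _ _) v x) = x := rep_app ts x.
  split=> v.
    by move=> x y; rewrite -!ksE => /ker_incl_inj e; rewrite -(tsE v x) e tsE.
  split=> [x|y /ker_inclE[x <-]]; first by rewrite -ksE ker_inclK.
  by exists ((t : rep_hom _ _) v x); rewrite ktE.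
split=> [|T h fh]; first by apply: rep_hom_ext => v x; case: (kf v) => + _; apply.
have [v t|h' h'E] := rep_corestrict (h := h) inj.
  by case: (kf v) => _; apply; exact: (rep_app fh t).
exists h'; split=> [|h2 h2E]; first exact: rep_hom_ext.
by apply: rep_hom_ext => v t; apply: inj; rewrite h'E -h2E.
Qed.
End KerCoker.

Lemma rep_exactP X Y Z (f : rep_hom X Y) (g : rep_hom Y Z) :
  is_exact (C := RepCat Q R) f g <-> forall v, exact_at (f v) (g v).
Proof.
split=> [[K [k [e [/rep_kernelP[_ gk] /rep_epiP surj ->]]]] v|fg].
  case: (gk v) => gk0 kg; split=> [x|y /kg[z <-]]; first exact: gk0.
  by have [x <-] := surj v z; exists x.
have [v t|e eE] := rep_corestrict (k := rep_ker_incl g) (h := f)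
  (fun v => @ker_incl_inj _ _ _ (g v)).
  by apply: ker_inclE; case: (fg v).
exists (rep_ker g : rep Q R), (rep_ker_incl g), e; split; first exact: rep_ker_is_kernel.
  apply/rep_epiP => v z; have [x fx] := proj2 (fg v) _ (ker_inclK z).
  by exists x; apply: (@ker_incl_inj _ _ _ (g v)); rewrite -fx -eE.
by apply: rep_hom_ext => v x; exact: esym (eE v x).
Qed.

End RepCategoryTheory.

(** * Fans of syzygies *)

Section Fans.
Variables (Q : quiver) (R : pzRingType).
Implicit Types X Y Z : rep Q R.

Definition in_of (a : arrow Q) : in_arrow (tgt a) := exist _ a (eqxx (tgt a)).

(** Reduces statements on the arrows into v, where v is only propositionally the
target, to the case of a literal target. *)
Lemma in_arrow_ind (S : forall v, in_arrow v -> Prop) :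
  (forall a, S (tgt a) (in_of a)) -> forall v (a : @in_arrow Q v), S v a.
Proof.
move=> Sa v [a e]; have ev := eqP e; subst v.
by rewrite (Prop_irrelevance e (eqxx _)); exact: Sa.
Qed.

Lemma rep_in_map_of X a x : rep_in_map X (in_of a) x = rep_map X a x.
Proof.
by rewrite /rep_in_map (Prop_irrelevance (eqP (valP (in_of a))) erefl).
Qed.

Lemma rep_in_map_nat X Y (f : rep_hom X Y) v (a : in_arrow v) x :
  f v (rep_in_map X a x) = rep_in_map Y a (f (src (val a)) x).
Proof.
move: v a x; apply: in_arrow_ind => a x.
by rewrite !rep_in_map_of rep_hom_nat.
Qed.

Lemma rep_fan_in X v (a : in_arrow v) x :
  rep_fan X v (dsum_in (fun a : in_arrow v => X (src (val a))) a x) = rep_in_map X a x.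
Proof. exact: dsum_lin_in. Qed.

Definition rep_dsum_fun X Y (f : rep_hom X Y) v : {linear rep_dsum X v -> rep_dsum Y v} :=
  dsum_fun (fun a : in_arrow v => f (src (val a))).

Lemma rep_fan_nat X Y (f : rep_hom X Y) v x :
  f v (rep_fan X v x) = rep_fan Y v (rep_dsum_fun f v x).
Proof.
apply: (@dsum_ext _ _ _ _ (lin_comp (f v) (rep_fan X v))
          (lin_comp (rep_fan Y v) (rep_dsum_fun f v))) => a y /=.
by rewrite /rep_dsum_fun dsum_fun_in !rep_fan_in rep_in_map_nat.
Qed.

Definition fan_coker_map X Y (f : rep_hom X Y) v :
    {linear coker (rep_fan X v) -> coker (rep_fan Y v)} :=
  coker_map (@rep_fan_nat X Y f v).

Lemma fan_coker_mapE X Y (f : rep_hom X Y) v y :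
  fan_coker_map f v (cproj (rep_fan X v) y) = cproj (rep_fan Y v) (f v y).
Proof. exact: coker_mapE. Qed.

(** The chase at an element x of X2 with g x = fan y: the image of y in Phi X4 vanishes
because the fan of X4 is injective, so y lifts to y' in Phi X2, and x minus
fan y' comes from X1. *)
Lemma fan_coker_exact X1 X2 X3 X4 (f : rep_hom X1 X2) (g : rep_hom X2 X3)
    (h : rep_hom X3 X4) v :
  (forall w, exact_at (f w) (g w)) -> (forall w, exact_at (g w) (h w)) ->
  injective (rep_fan X4 v) ->
  exact_at (fan_coker_map f v) (fan_coker_map g v).
Proof.
move=> fg gh inj4.
have [gf0 gfE] := fg v; have [hg0 _] := gh v.
have [Ghg0 GhgE] : exact_at (rep_dsum_fun g v) (rep_dsum_fun h v).
  by apply: dsum_fun_exact => a; exact: gh.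
split=> [c|c gc].
  by have [x <-] := cproj_surj c; rewrite !fan_coker_mapE gf0 linear0.
have [x xc] := cproj_surj c; subst c.
move: gc; rewrite fan_coker_mapE => /cproj_eq0[y yE].
have /GhgE[y' y'E] : rep_dsum_fun h v y = 0.
  by apply: inj4; rewrite -rep_fan_nat yE hg0 linear0.
have /gfE[z zE] : g v (x - rep_fan X2 v y') = 0.
  by rewrite linearB /= rep_fan_nat y'E yE subrr.
exists (cproj (rep_fan X1 v) z); rewrite fan_coker_mapE zE linearB /=.
by rewrite cprojK subr0.
Qed.

End Fans.

Section GorensteinProjectiveRep.
Variables (Q : quiver) (R : pzRingType).
Hypotheses (hQ : sink_projective Q) (gorR : left_gorenstein R).

Lemma rep_projective_at (X : rep Q R) v :
  is_projective (C := RepCat Q R) X -> is_projective (C := ModCat R) (X v).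
Proof. by case/hQ => + _; apply. Qed.

Lemma rep_projective_fan (X : rep Q R) v :
  is_projective (C := RepCat Q R) X ->
  exists r : {linear X v -> rep_dsum X v}, forall x, r (rep_fan X v x) = x.
Proof. by case/hQ => _ /(_ v)[r rf]; exists r => x; exact: (lin_app rf x). Qed.

(** The split fan makes its cokernel a direct summand of the projective X v. *)
Lemma rep_projective_fan_coker (X : rep Q R) v :
  is_projective (C := RepCat Q R) X ->
  is_projective (C := ModCat R) (coker (rep_fan X v) : lmodType R).
Proof.
move=> Xp; have [r rf] := rep_projective_fan v Xp.
have [x|i iE] := lin_factor (h := lin_sub (lin_id _) (lin_comp (rep_fan X v) r))
  (@cproj_surj _ _ _ (rep_fan X v)).
  by case/cproj_eq0 => y <- /=; rewrite rf subrr.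
have ri : comp (c := ModCat R) (cproj (rep_fan X v)) i = lin_id _.
  apply: linear_ext => c; have [y <-] := cproj_surj c.
  by rewrite /= iE linearB /= cprojK subr0.
exact: (projective_retract (@rep_projective_at X v Xp) ri).
Qed.

Section Complex.
Variables (P : int -> rep Q R) (d : forall i, rep_hom (P i) (P (i + 1))).
Hypothesis Pp : forall i, is_projective (C := RepCat Q R) (P i).
Hypothesis ex : forall i, is_exact (C := RepCat Q R) (d i) (d (i + 1)).

Let ex_at i v : exact_at (d i v) (d (i + 1) v).
Proof. by move: v; apply/rep_exactP/ex. Qed.

Let ex_mod v i : is_exact (C := ModCat R) (d i v) (d (i + 1) v).
Proof. exact/mod_exactP. Qed.

Let fan_inj i v : injective (rep_fan (P i) v).
Proof. by have [r rf] := rep_projective_fan v (@Pp i); exact: can_inj rf. Qed.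

Variables (M : rep Q R) (k : rep_hom M (P 0)).
Hypothesis kk : is_kernel (C := RepCat Q R) (d 0) k.

Lemma rep_gproj_at v : is_gproj (C := ModCat R) (M v).
Proof.
apply: (@mod_gproj R (M v) (fun i => P i v) (fun i => d i v) (k v)) => //.
  by move=> i; exact: rep_projective_at.
by apply/mod_kernelP; case/rep_kernelP: kk.
Qed.

Lemma rep_gproj_fan_inj v : injective (rep_fan M v).
Proof.
have [inj _] := (rep_kernelP _ _).1 kk.
move=> x y fxy; have : injective (rep_dsum_fun k v) by apply: dsum_fun_inj.
by apply; apply: (@fan_inj 0 v); rewrite -!rep_fan_nat fxy.
Qed.

(** The complex of the cokernels of the fans of the P i consists of projectives and
is exact; [fan_coker_exact] applied to M -> M -> P 0 -> P 1, with first map zero,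
and to M -> P 0 -> P 1 -> P 2 identifies the cokernel for M with its syzygy. *)
Lemma rep_gproj_fan_coker v :
  is_gproj (C := ModCat R) (coker (rep_fan M v) : lmodType R).
Proof.
have [inj kd] := (rep_kernelP _ _).1 kk.
apply: (@mod_gproj R _ (fun i => coker (rep_fan (P i) v))
  (fun i => fan_coker_map (d i) v) (fan_coker_map k v)) => //.
- by move=> i; exact: rep_projective_fan_coker.
- by move=> i; apply/mod_exactP; apply: fan_coker_exact.
apply/mod_kernelP; split; last first.
  by apply: (fan_coker_exact (h := d (0 + 1))).
have [_ kerE] : exact_at (fan_coker_map (rep_zero M M) v) (fan_coker_map k v).
  apply: (fan_coker_exact (h := d 0)) => // w.
  split=> [x|y ky]; first by rewrite /= linear0.
  by exists 0; apply: (inj w); rewrite ky !linear0.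
apply: lin_inj => c /kerE[c' <-]; have [x <-] := cproj_surj c'.
by rewrite fan_coker_mapE /= linear0.
Qed.

End Complex.
End GorensteinProjectiveRep.

(** * Total acyclicity of exact complexes of projective representations *)

Section RepHomExact.
Variables (Q : quiver) (R : pzRingType).

(** The maps h a make the modules L v * P v into an extension of P by L, in which
the arrow a also sends p to h a p. As P is projective the extension splits, and
the first component of a section is g. *)
Lemma rep_coboundary (P L : rep Q R)
    (h : forall a, {linear P (src a) -> L (tgt a)}) :
  is_projective (C := RepCat Q R) P ->
  exists g : forall v, {linear P v -> L v},
    forall a x, g (tgt a) (rep_map P a x) = rep_map L a (g (src a) x) + h a x.
Proof.
move=> Pp.
have elin a : linear (fun p : L (src a) * P (src a) =>
    (rep_map L a p.1 + h a p.2, rep_map P a p.2)).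
  move=> c p q /=; congr pair; last by rewrite linearP.
  by rewrite !linearP addrACA -scalerDr.
pose ext := Rep (rep_obj := fun v => (L v * P v)%type : lmodType R)
  (fun a => to_linear (elin a)).
have plin v : linear (fun p : ext v => p.2 : P v) by [].
have pnat a (p : ext (src a)) : to_linear (plin (tgt a)) (rep_map ext a p) =
    rep_map P a (to_linear (plin (src a)) p).
  by rewrite !to_linearE.
pose p : rep_hom ext P :=
  RepHom (rep_hom_val := fun v => to_linear (plin v)) pnat.
have [s ps] : exists s : rep_hom P ext, rep_comp p s = rep_id P.
  apply: Pp; apply/rep_epiP => v y; exists ((0, y) : ext v).
  by rewrite /= to_linearE.
have glin v : linear (fun x => (s v x).1).
  by move=> a x y; rewrite linearP.
exists (fun v => to_linear (glin v)) => a x; rewrite !to_linearE rep_hom_nat /=.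
rewrite to_linearE /=; congr (_ + h a _).
by have := rep_app ps x; rewrite /= to_linearE.
Qed.

Hypotheses (hQ : sink_projective Q) (gorR : left_gorenstein R).
Variables (P : int -> rep Q R) (d : forall i, rep_hom (P i) (P (i + 1))).
Hypothesis Pp : forall i, is_projective (C := RepCat Q R) (P i).
Hypothesis ex : forall i, is_exact (C := RepCat Q R) (d i) (d (i + 1)).

(** At each vertex u factors through some w v, but these need not commute with the
arrows. The defects h a vanish on boundaries, hence factor through maps k a; by
[rep_coboundary] the k a are themselves the defects of a family g, and
subtracting g from w restores naturality. *)
Lemma rep_hom_exact (L : rep Q R) i (u : rep_hom (P (i + 1)) L) :
  is_projective (C := RepCat Q R) L -> rep_comp u (d i) = rep_zero (P i) L ->
  exists w : rep_hom (P (i + 1 + 1)) L, u = rep_comp w (d (i + 1)).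
Proof.
move=> Lp ud.
have exm v j : exact_at (d j v) (d (j + 1) v) by move: v; apply/rep_exactP/ex.
have hom v w := hom_exact_projective (P := fun j => P j v) (d := fun j => d j v)
  (fun j => @rep_projective_at Q R hQ (P j) v (@Pp j))
  (fun j => (mod_exactP _ _).2 (exm v j)) gorR (@rep_projective_at Q R hQ L w Lp).
have hw v : exists w : {linear P (i + 1 + 1) v -> L v},
    forall x, w (d (i + 1) v x) = u v x.
  by apply: hom => x; exact: (rep_app ud x).
pose w v := projT1 (cid (hw v)).
have wE v x : w v (d (i + 1) v x) = u v x by rewrite /w; case: cid.
pose h a := lin_sub (lin_comp (w (tgt a)) (rep_map (P (i + 1 + 1)) a))
                    (lin_comp (rep_map L a) (w (src a))).
have hk a : exists k : {linear P (i + 1 + 1 + 1) (src a) -> L (tgt a)},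
    forall x, k (d (i + 1 + 1) (src a) x) = h a x.
  by apply: hom => x; rewrite /= -rep_hom_nat !wE rep_hom_nat subrr.
have [g gE] := rep_coboundary (fun a => projT1 (cid (hk a))) (@Pp (i + 1 + 1 + 1)).
(* w corrected by a map that vanishes on the image of d (i + 1). *)
pose z v := lin_sub (w v) (lin_comp (g v) (d (i + 1 + 1) v)).
have znat a x : z (tgt a) (rep_map (P (i + 1 + 1)) a x) = rep_map L a (z (src a) x).
  rewrite /= rep_hom_nat gE linearB /=; case: cid => k /= ->.
  by rewrite /= opprD opprB addrC -addrA subrK addrC.
exists (RepHom (rep_hom_val := z) znat).
apply: rep_hom_ext => v x /=; rewrite wE.
by case: (exm v (i + 1)) => -> _; rewrite linear0 subr0.
Qed.

Lemma rep_gproj (M : rep Q R) (k : rep_hom M (P 0)) :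
  is_kernel (C := RepCat Q R) (d 0) k -> is_gproj (C := RepCat Q R) M.
Proof.
move=> kk; exists P, d, k; split=> // L Lp i u; split=> [ud|[w ->]].
  exact: rep_hom_exact.
by rewrite -compmA (exact_comp0 (ex i)) compm0.
Qed.

End RepHomExact.

(** * Representations spanned by words of arrows *)

(** Finite and infinite backward paths have the same formal structure: a word is
either empty or consists of a last arrow and the word before it, and it ends at
certain vertices. The label is the place where a finite path starts; being kept
apart from the word, it does not change when an arrow is added, so that the
coefficient modules W (label) match on the nose. *)
Record word_system (Q : quiver) := WordSystem {
  label : choiceType;
  word : choiceType;
  wcons : arrow Q -> word -> word;
  wuncons : word -> option (arrow Q * word);
  wends : label -> word -> vertex Q -> bool;
  wconsK : forall a l, wuncons (wcons a l) = Some (a, l);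
  wunconsK : forall a l l', wuncons l = Some (a, l') -> wcons a l' = l;
  wends_cons : forall i a l v,
    wends i (wcons a l) v = (tgt a == v) && wends i l (src a)
}.

Section WordRep.
Variables (Q : quiver) (S : word_system Q) (R : pzRingType) (W : label S -> lmodType R).

Definition words_to (v : vertex Q) : choiceType :=
  {p : label S * word S | wends p.1 p.2 v}.

Fact wcons_to_subproof v (a : in_arrow v) (s : words_to (src (val a))) :
  wends (val s).1 (wcons (val a) (val s).2) v.
Proof. by rewrite wends_cons (valP a) (valP s). Qed.
Definition wcons_to v (a : in_arrow v) (s : words_to (src (val a))) : words_to v :=
  exist _ ((val s).1, wcons (val a) (val s).2) (wcons_to_subproof s).

Lemma wcons_toE v (s : words_to v) : wuncons (val s).2 <> None ->
  exists (a : in_arrow v) (s' : words_to (src (val a))), s = wcons_to s'.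
Proof.
case: s => [[i l] e] /=; case E: (wuncons l) => [[a l']|] // _.
have el := wunconsK E; subst l; have := e; rewrite /= wends_cons => /andP[ea el].
exists (exist _ a ea), (exist _ (i, l') el : words_to (src a)); exact: val_inj.
Qed.

Definition word_mod (v : vertex Q) (s : words_to v) : lmodType R := W (val s).1.

Definition word_in v (s : words_to v) : {linear W (val s).1 -> dsum (@word_mod v)} :=
  dsum_in (@word_mod v) s.

Definition word_lin v (N : lmodType R)
    (f : forall s : words_to v, {linear W (val s).1 -> N}) :
    {linear dsum (@word_mod v) -> N} := dsum_lin (M := @word_mod v) f.

Lemma word_lin_in v (N : lmodType R)
    (f : forall s : words_to v, {linear W (val s).1 -> N}) s x :
  word_lin f (word_in s x) = f s x.
Proof. exact: dsum_lin_in. Qed.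

Definition word_rep : rep Q R :=
  Rep (rep_obj := fun v => dsum (@word_mod v) : lmodType R)
      (fun a => word_lin (fun s : words_to (src a) =>
                            word_in (wcons_to (a := in_of a) s))).

Lemma word_rep_in_map v (a : in_arrow v) (s : words_to (src (val a))) x :
  rep_in_map word_rep a (word_in s x) = word_in (wcons_to s) x.
Proof.
move: v a s x; apply: in_arrow_ind => a s x.
by rewrite rep_in_map_of /= word_lin_in.
Qed.

Lemma word_ext v (L : lmodType R) (f g : {linear word_rep v -> L}) :
  (forall s x, f (word_in s x) = g (word_in s x)) -> f =1 g.
Proof. exact: dsum_ext. Qed.

Definition fan_in v (a : in_arrow v) :
    {linear word_rep (src (val a)) -> rep_dsum word_rep v} :=
  dsum_in (fun a : in_arrow v => word_rep (src (val a))) a.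

Lemma word_fan_ext v (L : lmodType R) (f g : {linear rep_dsum word_rep v -> L}) :
  (forall a s x, f (fan_in a (word_in s x)) = g (fan_in a (word_in s x))) -> f =1 g.
Proof.
move=> fg; apply: dsum_ext => a.
apply: (@word_ext _ _ (lin_comp f (fan_in a)) (lin_comp g (fan_in a))).
exact: fg.
Qed.

Lemma word_fan v (a : in_arrow v) (s : words_to (src (val a))) x :
  rep_fan word_rep v (fan_in a (word_in s x)) = word_in (wcons_to s) x.
Proof. by rewrite rep_fan_in word_rep_in_map. Qed.

Definition uncons_ends i v (o : option (arrow Q * word S)) : bool :=
  if o is Some (a, l) then (tgt a == v) && wends i l (src a) else true.

Fact uncons_endsP i l v : wends i l v -> uncons_ends i v (wuncons l).
Proof.
case E: (wuncons l) => [[a l']|] //= e.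
by rewrite -wends_cons (wunconsK E).
Qed.

(** Inverts the fan on the words that have a last arrow a: the word without a, in
the summand of a. *)
Definition word_drop_at i v (o : option (arrow Q * word S)) :
    uncons_ends i v o -> {linear W i -> rep_dsum word_rep v} :=
  if o is Some (a, l) then
    fun e => lin_comp (fan_in (exist _ a (proj1 (andP e)) : in_arrow v))
                      (word_in (exist _ (i, l) (proj2 (andP e)) : words_to (src a)))
  else fun _ => lin_zero _ _.

Definition word_drop v : {linear word_rep v -> rep_dsum word_rep v} :=
  word_lin (fun s => word_drop_at (uncons_endsP (valP s))).

Lemma word_drop_in v (s : words_to v) x :
  word_drop v (word_in s x) = word_drop_at (uncons_endsP (valP s)) x.
Proof. exact: word_lin_in. Qed.

Lemma word_drop_cons v (a : in_arrow v) (s : words_to (src (val a))) x :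
  word_drop v (word_in (wcons_to s) x) = fan_in a (word_in s x).
Proof.
rewrite word_drop_in; move: (uncons_endsP _) => /=; rewrite wconsK /= => e.
case: a s x e => a ea [[i l] el] /= x e.
by rewrite (Prop_irrelevance (proj1 (andP e)) ea) (Prop_irrelevance (proj2 (andP e)) el).
Qed.

Lemma word_drop_nil v (s : words_to v) x :
  wuncons (val s).2 = None -> word_drop v (word_in s x) = 0.
Proof.
by rewrite word_drop_in; move: (uncons_endsP _) => /= + E; rewrite E.
Qed.

Lemma word_dropK v x : word_drop v (rep_fan word_rep v x) = x.
Proof.
apply: (@word_fan_ext _ _ (lin_comp (word_drop v) (rep_fan word_rep v)) (lin_id _)).
by move=> a s y /=; rewrite word_fan word_drop_cons.
Qed.

Lemma word_fan_drop v (s : words_to v) x : wuncons (val s).2 <> None ->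
  rep_fan word_rep v (word_drop v (word_in s x)) = word_in s x.
Proof.
move=> /wcons_toE[a [s' e]]; move: s e x => _ -> x.
by rewrite word_drop_cons word_fan.
Qed.

(** The retraction [word_drop] splits the fans, which suffices over a sink projective
quiver. *)
Lemma word_rep_projective : sink_projective Q ->
  (forall i, is_projective (C := ModCat R) (W i)) ->
  is_projective (C := RepCat Q R) word_rep.
Proof.
move=> hQ Wp; apply/hQ; split=> v.
  by apply: dsum_projective => s; exact: Wp.
by exists (word_drop v); apply: linear_ext => x; exact: word_dropK.
Qed.

End WordRep.

(** * Sink projective quivers have no infinite backward path *)

Section NoInfinitePath.
Variable Q : quiver.

Section Shift.
Variables (R : pzRingType) (X : rep Q R).

(** The polynomials over X, on which an arrow also raises the degree by one. *)
Definition shift_rep : rep Q R :=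
  Rep (rep_obj := fun v => dsum (fun _ : nat => X v) : lmodType R)
    (fun a => dsum_lin (fun n =>
       lin_comp (dsum_in (fun _ : nat => X (tgt a)) n.+1) (rep_map X a))).

Definition shift_sum v : {linear shift_rep v -> X v} :=
  dsum_lin (fun _ : nat => lin_id (X v)).

Fact shift_sum_nat a x :
  shift_sum (tgt a) (rep_map shift_rep a x) = rep_map X a (shift_sum (src a) x).
Proof.
apply: (@dsum_ext _ _ _ _ (lin_comp (shift_sum (tgt a)) (rep_map shift_rep a))
          (lin_comp (rep_map X a) (shift_sum (src a)))) => n y /=.
by rewrite /shift_sum !dsum_lin_in.
Qed.
Definition shift_fold : rep_hom shift_rep X := RepHom shift_sum_nat.

Lemma shift_pr v (a : in_arrow v) n (x : shift_rep (src (val a))) :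
  dsum_pr (fun _ : nat => X v) n (rep_in_map shift_rep a x) =
  if n is m.+1 then rep_in_map X a (dsum_pr (fun _ : nat => X (src (val a))) m x) else 0.
Proof.
move: v a n x; apply: in_arrow_ind => a n x; rewrite rep_in_map_of.
case: n => [|m].
  apply: (@dsum_ext _ _ _ _ (lin_comp (dsum_pr (fun _ : nat => X (tgt a)) 0%N)
    (rep_map shift_rep a)) (lin_zero _ _)) => k y /=.
  by rewrite dsum_lin_in /= dsum_pr_in_neq.
rewrite rep_in_map_of.
apply: (@dsum_ext _ _ _ _
  (lin_comp (dsum_pr (fun _ : nat => X (tgt a)) m.+1) (rep_map shift_rep a))
  (lin_comp (rep_map X a) (dsum_pr (fun _ : nat => X (src a)) m))) => k y /=.
rewrite dsum_lin_in /=; have [->|km] := eqVneq k m.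
  by rewrite !dsum_pr_in.
by rewrite !dsum_pr_in_neq ?linear0 // => [e|[e]]; move: km; rewrite e eqxx.
Qed.

(** A projective X is a direct summand of its polynomials through the sum of
coefficients. Every element of X is a sum of images under arrows, and so, for
each n, under paths of length n + 1; its image in the polynomials has therefore
no coefficient of degree at most n. *)
Lemma rep_projective_fan_surj : is_projective (C := RepCat Q R) X ->
  (forall v x, exists y, rep_fan X v y = x) -> forall v (x : X v), x = 0.
Proof.
move=> Xp surj.
have [s ss] : exists s : rep_hom X shift_rep, rep_comp shift_fold s = rep_id X.
  apply: Xp; apply/rep_epiP => v y.
  exists (dsum_in (fun _ : nat => X v) 0%N y).
  by rewrite /= /shift_sum dsum_lin_in.
have s0 n v x : dsum_pr (fun _ : nat => X v) n (s v x) = 0.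
  elim: n v x => [|n IH] v x; have [y <-] := surj v x;
    apply: (@dsum_ext _ _ _ _ (lin_comp (dsum_pr (fun _ : nat => X v) _)
      (lin_comp (s v) (rep_fan X v))) (lin_zero _ _)) => a z /=;
    by rewrite rep_fan_in rep_in_map_nat shift_pr ?IH ?linear0.
move=> v x; rewrite -[x](rep_app ss x) /=.
suff -> : s v x = 0 by rewrite linear0.
by apply: dsum_eqP => n; rewrite -!dsum_prE s0 linear0.
Qed.

End Shift.

Definition pred_vertex (u v : vertex Q) : Prop := exists a, src a = u /\ tgt a = v.

Definition inf_path (p : nat -> arrow Q) (v : vertex Q) : Prop :=
  tgt (p 0%N) = v /\ forall n, tgt (p n.+1) = src (p n).

Fact inf_path_cons a p v :
  inf_path (fun n => if n is m.+1 then p m else a) v <->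
  tgt a = v /\ inf_path p (src a).
Proof.
split=> [[tv tS]|[tv [t0 tS]]]; last by split=> // -[].
by split=> //; split=> [|n]; exact: (tS _).
Qed.

(** A vertex that is not accessible has a predecessor of the same kind. *)
Lemma not_acc_inf_path v : ~ Acc pred_vertex v -> exists p, inf_path p v.
Proof.
move=> nv; pose N := {u | ~ Acc pred_vertex u}.
have /choice[f fP] (u : N) : exists a, tgt a = sval u /\ ~ Acc pred_vertex (src a).
  apply: contrapT => /forallNP na; apply: (svalP u).
  constructor=> w [a [aw au]]; apply: contrapT => nw.
  by apply: (na a); split=> //=; rewrite aw.
pose next (u : N) : N := exist _ (src (f u)) (proj2 (fP u)).
pose st n := iter n next (exist _ v nv : N).
exists (fun n => f (st n)); split=> [|n]; first by case: (fP (st 0%N)).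
by case: (fP (st n.+1)).
Qed.

Fact inf_wconsK (a : arrow Q) (p : nat -> arrow Q) :
  Some ((fun n => if n is m.+1 then p m else a) 0%N,
        fun n => (fun n => if n is m.+1 then p m else a) n.+1) = Some (a, p).
Proof. by []. Qed.

Fact inf_wunconsK (a : arrow Q) (p p' : nat -> arrow Q) :
  Some (p 0%N, fun n => p n.+1) = Some (a, p') ->
  (fun n => if n is m.+1 then p' m else a) = p.
Proof. by move=> [<- <-]; apply/funext => -[]. Qed.

Fact inf_wends_cons (i : unit) (a : arrow Q) (p : nat -> arrow Q) v :
  `[< inf_path (fun n => if n is m.+1 then p m else a) v >] =
  (tgt a == v) && `[< inf_path p (src a) >].
Proof.
apply/asboolP/andP => [/inf_path_cons[-> pa]|[/eqP ta /asboolP pa]].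
  by split=> //; apply/asboolP.
exact/inf_path_cons.
Qed.

Definition inf_system : word_system Q :=
  @WordSystem Q unit {classic nat -> arrow Q} _ _ (fun _ p v => `[< inf_path p v >])
    inf_wconsK inf_wunconsK inf_wends_cons.

(** The words are the infinite backward paths and the ring is that of the integers.
Every word has a last arrow, so the fans are onto. *)
Lemma sink_projective_wf : sink_projective Q -> well_founded pred_vertex.
Proof.
move=> hQ v; apply: contrapT => /not_acc_inf_path[p pv].
pose W (i : label inf_system) : lmodType int := int^o : lmodType int.
have Xp : is_projective (C := RepCat Q int) (word_rep W).
  by apply: word_rep_projective => // i; exact: regular_projective.
have surj u x : exists y, rep_fan (word_rep W) u y = x.
  exists (word_drop W u x).
  apply: (@word_ext _ _ _ _ _ _
    (lin_comp (rep_fan (word_rep W) u) (word_drop W u)) (lin_id _)).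
  by move=> s y /=; rewrite word_fan_drop.
have e : wends (w := inf_system) tt p v by apply/asboolP.
pose s : words_to inf_system v := exist _ (tt : label inf_system, p : word inf_system) e.
have := rep_projective_fan_surj Xp surj (word_in W s (1 : int)).
move=> /(congr1 (dsum_pr _ s)).
by rewrite linear0 /word_in dsum_pr_in.
Qed.

End NoInfinitePath.

(** * Representations induced from the vertices *)

Section FinitePaths.
Variable Q : quiver.

Fixpoint path_from (u : vertex Q) (l : seq (arrow Q)) (v : vertex Q) : bool :=
  if l is a :: l' then (tgt a == v) && path_from u l' (src a) else u == v.

Fact path_unconsK (a : arrow Q) (l l' : seq (arrow Q)) :
  (if l is b :: l1 then Some (b, l1) else None) = Some (a, l') -> a :: l' = l.
Proof. by case: l => // b l1 [-> ->]. Qed.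

Definition path_system : word_system Q :=
  @WordSystem Q (vertex Q) (seq (arrow Q)) (fun a l => a :: l)
    (fun l => if l is a :: l' then Some (a, l') else None) path_from
    (fun a l => erefl) path_unconsK (fun u a l v => erefl).

Variable R : pzRingType.

Section Induced.
Variable W : vertex Q -> lmodType R.

(** The left adjoint of restriction to the vertices, on the finite paths. *)
Definition induced : rep Q R := word_rep (S := path_system) W.

Definition nil_to v : words_to path_system v :=
  exist _ (v : label path_system, [::] : word path_system) (eqxx v).

Definition induced_in v : {linear W v -> induced v} :=
  word_in (S := path_system) W (nil_to v).

Definition top_at u (l : seq (arrow Q)) v : path_from u l v -> {linear W u -> W v} :=
  if l is [::] then fun e => ecast w {linear W u -> W w} (eqP e) (lin_id (W u))
  else fun _ => lin_zero _ _.

(** The projection onto the trivial paths, a cokernel of the fan. *)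
Definition induced_top v : {linear induced v -> W v} :=
  word_lin (fun s : words_to path_system v => top_at (valP s)).

Lemma induced_top_word v (s : words_to path_system v) x :
  induced_top v (word_in (S := path_system) W s x) = top_at (valP s) x.
Proof. exact: word_lin_in. Qed.

Definition induced_drop v : {linear induced v -> rep_dsum induced v} :=
  word_drop (S := path_system) W v.

Lemma induced_dropK v x : induced_drop v (rep_fan induced v x) = x.
Proof. exact: word_dropK. Qed.

Lemma induced_topK v x : induced_top v (induced_in v x) = x.
Proof.
rewrite -[LHS]/(induced_top v (word_in (S := path_system) W (nil_to v) x)).
rewrite induced_top_word /=.
by rewrite (Prop_irrelevance (eqP _) erefl).
Qed.

Lemma induced_top_fan v x : induced_top v (rep_fan induced v x) = 0.
Proof.
apply: (@word_fan_ext _ path_system _ W v _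
  (lin_comp (induced_top v) (rep_fan induced v)) (lin_zero _ _)).
by move=> a s y /=; rewrite word_fan induced_top_word.
Qed.

Lemma induced_decomp v x :
  x = rep_fan induced v (induced_drop v x) + induced_in v (induced_top v x).
Proof.
pose w s := word_in (S := path_system) W (v := v) s.
have ws s y : w s y = rep_fan induced v (induced_drop v (w s y)) +
    induced_in v (induced_top v (w s y)).
  rewrite induced_top_word; case: s y => [[u [|a l]] e] y.
    have uv := eqP e; simpl in uv; subst u.
    rewrite [induced_drop _ _]word_drop_nil // linear0 add0r.
    rewrite (Prop_irrelevance e (eqxx v)) [X in induced_in v X](_ : _ = y) //=.
    by rewrite (Prop_irrelevance (eqP _) erefl).
  by rewrite [rep_fan _ _ _]word_fan_drop // linear0 addr0.
exact: (@word_ext _ path_system _ W v _ (lin_id _)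
  (lin_add (lin_comp (rep_fan induced v) (induced_drop v))
           (lin_comp (induced_in v) (induced_top v))) ws).
Qed.

Lemma induced_projective : sink_projective Q ->
  (forall v, is_projective (C := ModCat R) (W v)) ->
  is_projective (C := RepCat Q R) induced.
Proof.
by move=> hQ Wp; apply: (@word_rep_projective Q path_system R W hQ) => v; exact: Wp.
Qed.

Section Extension.
Variables (X : rep Q R) (h : forall v, {linear W v -> X v}).

Fixpoint path_act u (l : seq (arrow Q)) v : path_from u l v -> {linear X u -> X v} :=
  if l is a :: l' then
    fun e => lin_comp (rep_in_map X (exist _ a (proj1 (andP e)) : in_arrow v))
                      (path_act (proj2 (andP e)))
  else fun e => ecast w {linear X u -> X w} (eqP e) (lin_id (X u)).

Definition induced_ext_at v : {linear induced v -> X v} :=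
  word_lin (fun s : words_to path_system v =>
    lin_comp (path_act (valP s)) (h (val s).1)).

Lemma induced_ext_word v (s : words_to path_system v) x :
  induced_ext_at v (word_in (S := path_system) W s x) = path_act (valP s) (h (val s).1 x).
Proof. exact: word_lin_in. Qed.

Fact induced_ext_nat a x :
  induced_ext_at (tgt a) (rep_map induced a x) =
  rep_map X a (induced_ext_at (src a) x).
Proof.
have nat_word s y :
    induced_ext_at (tgt a) (rep_map induced a (word_in (S := path_system) W s y)) =
    rep_map X a (induced_ext_at (src a) (word_in (S := path_system) W s y)).
  rewrite -rep_in_map_of [rep_in_map _ _ _]word_rep_in_map !induced_ext_word.
  rewrite -rep_in_map_of /=.
  rewrite (Prop_irrelevance (proj1 _) (eqxx (tgt a))).
  by rewrite (Prop_irrelevance (proj2 _) (valP s)).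
exact: (@word_ext _ path_system _ W _ _
  (lin_comp (induced_ext_at (tgt a)) (rep_map induced a))
  (lin_comp (rep_map X a) (induced_ext_at (src a))) nat_word).
Qed.

(** The representation morphism adjoint to h. *)
Definition induced_ext : rep_hom induced X := RepHom induced_ext_nat.

Lemma induced_extE v y : induced_ext v (induced_in v y) = h v y.
Proof.
rewrite -[LHS]/(induced_ext_at v (word_in (S := path_system) W (nil_to v) y)).
rewrite induced_ext_word /=.
by rewrite (Prop_irrelevance (eqP _) erefl).
Qed.

End Extension.
End Induced.

Lemma enough_projectives (X : rep Q R) : sink_projective Q ->
  exists P (p : rep_hom P X),
    is_projective (C := RepCat Q R) P /\ forall v x, exists y, p v y = x.
Proof.
move=> hQ; exists (induced (fun v => free_mod R (X v))).
exists (induced_ext (fun v => free_cover (X v))).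
split=> [|v x]; first by apply: induced_projective => // v; exact: free_projective.
have [y <-] := free_cover_surj x.
by exists (induced_in (fun v => free_mod R (X v)) v y); rewrite induced_extE.
Qed.

End FinitePaths.

(** * Gorenstein projective modules *)

Section GprojModules.
Variable R : pzRingType.
Implicit Types A B C K L W : lmodType R.

(** The start of a coresolution by projectives within the Gorenstein projective
modules. *)
Record gproj_embedding C := GprojEmbedding {
  ge_mid : lmodType R;
  ge_quot : lmodType R;
  ge_in : {linear C -> ge_mid};
  ge_out : {linear ge_mid -> ge_quot};
  ge_projective : is_projective (C := ModCat R) ge_mid;
  ge_gproj : is_gproj (C := ModCat R) ge_quot;
  ge_inj : injective ge_in;
  ge_exact : exact_at ge_in ge_out;
  ge_surj : forall y, exists x, ge_out x = y
}.

(** In a complete resolution P with syzygy C, the next syzygy is a syzygy of the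
shifted complex. *)
Lemma gproj_embed C : is_gproj (C := ModCat R) C -> gproj_embedding C.
Proof.
move=> /cid[P /cid[d /cid[k [Pp ex /mod_kernelP[injk [dk kd]] hom]]]].
have /cid[K /cid[k' /cid[e [kk' epi dE]]]] := ex 0.
have [injk' _] := (mod_kernelP _ _).1 kk'.
have dE0 x : (d 0 : {linear _ -> _}) x =
    (k' : {linear _ -> _}) ((e : {linear _ -> _}) x) := lin_app dE x.
apply: (@GprojEmbedding C (P 0) K k e) => //.
- exists (fun i => P (i + 1)), (fun i => d (i + 1)), k'.
  by split=> // L Lp i u; apply: hom.
- split=> [x|y ey]; first by apply: injk'; rewrite -dE0 dk linear0.
  by apply: kd; rewrite dE0 ey linear0.
- exact/mod_epiP.
Qed.

Lemma gproj_iso A B (s : {linear A -> B}) :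
  injective s -> (forall y, exists x, s x = y) ->
  is_gproj (C := ModCat R) B -> is_gproj (C := ModCat R) A.
Proof.
move=> injs surj [P [d [k [Pp ex /mod_kernelP[injk [dk kd]] hom]]]].
exists P, d, (lin_comp k s); split=> //; apply/mod_kernelP; split=> [x y /injk/injs //|].
split=> [x|y /kd[z <-]]; first exact: dk.
by have [x <-] := surj z; exists x.
Qed.

(** This is Ext^1(C, L) = 0 for C = coker f. Lift a projective presentation
P (-2) -> P (-1) -> C to alpha : P (-2) -> A and beta : P (-1) -> B. Exactness of
Hom(P, L) extends phi o alpha to psi on P (-1), and phi + psi descends from
A * P (-1) to its quotient B. *)
Lemma gproj_extend A B L (f : {linear A -> B}) (phi : {linear A -> L}) :
  injective f -> is_gproj (C := ModCat R) (coker f : lmodType R) ->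
  is_projective (C := ModCat R) L ->
  exists psi : {linear B -> L}, forall x, psi (f x) = phi x.
Proof.
move=> injf [P [d [k0 [Pp ex kk0 hom]]]] Lp.
(* With i = -3 the presentation is P (i + 1) -> P (i + 1 + 1) -> C; writing 0 as
   i + 1 + 1 + 1 lets the differentials compose without transport. *)
pose i : int := -3%:Z.
have [k /mod_kernelP[injk [dk kd]]] : exists k : {linear coker f -> P (i + 1 + 1 + 1)},
    is_kernel (C := ModCat R) (d (i + 1 + 1 + 1)) k.
  have : 0 = i + 1 + 1 + 1 by [].
  by move: (i + 1 + 1 + 1) => z z0; subst z; exists k0.
pose dl z : {linear P z -> P (z + 1)} := d z.
have exl z : exact_at (dl z) (dl (z + 1)) := (mod_exactP _ _).1 (ex z).
have [eps epsE] : exists e : {linear P (i + 1 + 1) -> coker f},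
    forall x, k (e x) = dl (i + 1 + 1) x.
  by apply: lin_corestrict injk _ => x; apply: kd; case: (exl (i + 1 + 1)).
have eps_surj c : exists x, eps x = c.
  have [x dx] := proj2 (exl (i + 1 + 1)) _ (dk c).
  by exists x; apply: injk; rewrite epsE.
have eps_ker x : eps x = 0 -> exists y, dl (i + 1) y = x.
  by move=> ex0; apply: (proj2 (exl (i + 1))); rewrite -epsE ex0 linear0.
have eps_d y : eps (dl (i + 1) y) = 0.
  by apply: injk; rewrite epsE linear0; case: (exl (i + 1)).
have [beta betaE] : exists b : {linear P (i + 1 + 1) -> B},
    forall x, cproj f (b x) = eps x.
  have epi : is_epi (C := ModCat R) (cproj f) by apply/mod_epiP/cproj_surj.
  have [b bE] := @Pp (i + 1 + 1) _ _ _ epi eps.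
  by exists b => x; exact: (lin_app bE x).
have [alpha alphaE] : exists a : {linear P (i + 1) -> A},
    forall y, f (a y) = beta (dl (i + 1) y).
  apply: (lin_corestrict (h := lin_comp beta (dl (i + 1))) injf) => y.
  by apply/cproj_eq0; rewrite betaE eps_d.
have [psi psiE] : exists p : {linear P (i + 1 + 1) -> L},
    forall y, p (dl (i + 1) y) = phi (alpha y).
  have [+ _] := hom L Lp i (lin_comp phi alpha).
  case=> [|p pE]; last by exists p => y; exact: esym (lin_app pE y).
  apply: linear_ext => y /=; rewrite [alpha _](_ : _ = 0) ?linear0 //.
  by apply: injf; rewrite alphaE (proj1 (exl i)) !linear0.
have plin : linear (fun q : A * P (i + 1 + 1) => f q.1 + beta q.2).
  by move=> a p q /=; rewrite !linearP addrACA -scalerDr.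
have hlin : linear (fun q : A * P (i + 1 + 1) => phi q.1 + psi q.2).
  by move=> a p q /=; rewrite !linearP addrACA -scalerDr.
have [b|[a x]|h' h'E] := lin_factor (p := to_linear plin) (h := to_linear hlin).
- have [x xE] := eps_surj (cproj f b).
  have /cproj_eq0[a aE] : cproj f (b - beta x) = 0 by rewrite linearB /= betaE xE subrr.
  by exists (a, x); rewrite to_linearE /= aE subrK.
- rewrite !to_linearE /= => ax0.
  have /eps_ker[y yE] : eps x = 0.
    by have := congr1 (cproj f) ax0; rewrite linearD /= cprojK add0r linear0 betaE.
  subst x; rewrite psiE -linearD; suff -> : a + alpha y = 0 by rewrite linear0.
  by apply: injf; rewrite linearD /= alphaE ax0 linear0.
exists h' => x; by have := h'E (x, 0); rewrite !to_linearE /= !linear0 !addr0.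
Qed.

End GprojModules.

(** * Embedding into induced representations *)

Section Coresolution.
Variables (Q : quiver) (R : pzRingType).
Hypothesis hQ : sink_projective Q.

(** The property that passes from M to the cosyzygy of [fan_gproj_step], so that
the step can be iterated. *)
Definition fan_gproj (M : rep Q R) : Prop :=
  forall v, injective (rep_fan M v) /\
    is_gproj (C := ModCat R) (coker (rep_fan M v) : lmodType R).

Lemma rep_hom_fan (M P : rep Q R) (g : forall v, {linear M v -> P v}) :
  (forall v x, g v (rep_fan M v x) =
     rep_fan P v (dsum_fun (fun a : in_arrow v => g (src (val a))) x)) ->
  exists f : rep_hom M P, forall v x, f v x = g v x.
Proof.
move=> gfan.
have nat a x : g (tgt a) (rep_map M a x) = rep_map P a (g (src a) x).
  have := gfan (tgt a)
    (dsum_in (fun b : in_arrow (tgt a) => M (src (val b))) (in_of a) x).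
  by rewrite dsum_fun_in !rep_fan_in !rep_in_map_of.
by exists (RepHom nat).
Qed.

(** Well-founded recursion along the arrows: phi is the map induced by the maps
constructed at the sources, and the equation on fans is naturality. *)
Lemma fan_recursion (M P : rep Q R)
    (T : forall v, {linear M v -> P v} -> Prop) :
  (forall v (phi : {linear rep_dsum M v -> rep_dsum P v}),
     exists g : {linear M v -> P v},
       (forall x, g (rep_fan M v x) = rep_fan P v (phi x)) /\ T v g) ->
  exists f : rep_hom M P, forall v, T v (f v).
Proof.
move=> hext.
pose ext v phi := projT1 (cid (hext v phi)).
have extP v phi :
    (forall x, ext v phi (rep_fan M v x) = rep_fan P v (phi x)) /\ T v (ext v phi).
  by rewrite /ext; case: cid.
pose below (v : vertex Q) (a : in_arrow v) : pred_vertex (src (val a)) v :=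
  ex_intro _ (val a) (conj erefl (eqP (valP a))).
pose F v (rec : forall u, pred_vertex u v -> {linear M u -> P u}) :=
  ext v (dsum_fun (fun a : in_arrow v => rec _ (below v a))).
pose g := Fix (sink_projective_wf hQ) (fun v => {linear M v -> P v}) F.
have gE v : g v = ext v (dsum_fun (fun a : in_arrow v => g (src (val a)))).
  rewrite {1}/g Fix_eq // => w h1 h2 h12; congr F.
  by apply: functional_extensionality_dep => u; apply: functional_extensionality_dep.
have [v x|f fE] := @rep_hom_fan M P g.
  by rewrite {1}gE (proj1 (extP _ _)).
exists f => v; rewrite (_ : f v = g v); last exact: linear_ext.
by rewrite gE; case: (extP v (dsum_fun (fun a : in_arrow v => g (src (val a))))).
Qed.

(** The quotient N of P by M has the required property because, in the diagram with
rows Phi M -> M -> C, Phi P -> P -> W and Phi N -> N -> K, the columns and the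
first two rows are short exact, hence so is the third row. *)
Lemma fan_gproj_step (M : rep Q R) : fan_gproj M ->
  exists P N (i : rep_hom M P) (p : rep_hom P N),
    [/\ is_projective (C := RepCat Q R) P, fan_gproj N,
        forall v, injective (i v), forall v, exact_at (i v) (p v) &
        forall v y, exists x, p v x = y].
Proof.
move=> Mg.
pose D v := gproj_embed (proj2 (Mg v)).
pose W v := ge_mid (D v); pose K v := ge_quot (D v).
pose j v : {linear coker (rep_fan M v) -> W v} := ge_in (D v).
pose e v : {linear W v -> K v} := ge_out (D v).
have Wp v : is_projective (C := ModCat R) (W v) by exact: (@ge_projective _ _ (D v)).
pose P := induced W.
have Pp : is_projective (C := RepCat Q R) P by exact: induced_projective.
have fanPp v : is_projective (C := ModCat R) (rep_dsum P v).
  by apply: dsum_projective => a; exact: (@rep_projective_at Q R hQ P _ Pp).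
pose T v (g : {linear M v -> P v}) :=
  forall m, induced_top W v (g m) = j v (cproj (rep_fan M v) m).
have [v phi|i iT] := @fan_recursion M P T.
  have [injM Cg] := Mg v.
  have [t tE] := gproj_extend phi injM Cg (@fanPp v).
  (* P v is the sum of Phi P v and W v; the component in Phi P v extends phi, the
     one in W v is M v -> C v -> W v. *)
  exists (lin_add (lin_comp (rep_fan P v) t)
    (lin_comp (induced_in W v) (lin_comp (j v) (cproj (rep_fan M v))))).
  split=> [x|m] /=.
    by rewrite tE cprojK !linear0 addr0.
  by rewrite linearD induced_top_fan induced_topK add0r.
have injP v : injective (rep_fan P v) := can_inj (@induced_dropK _ _ W v).
have kerM v m : cproj (rep_fan M v) m = 0 -> exists z, rep_fan M v z = m.
  by move/cproj_eq0.
have injj v c : j v c = 0 -> c = 0.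
  by move=> jc; apply: (@ge_inj _ _ (D v)); rewrite [LHS]jc linear0.
(* An element of the kernel dies in C v, so it comes from Phi M v, where i is
   injective by induction along the arrows. *)
have inji v : injective (i v).
  elim: {v}(v : vertex Q) / (sink_projective_wf hQ v) => v _ IH.
  apply: lin_inj => m im0; have := iT v m; rewrite im0 linear0 => /esym/injj/kerM[z zm].
  have injfan : injective (rep_dsum_fun i v).
    by apply: dsum_fun_inj => a; apply: IH; exists (val a); rewrite (eqP (valP a)).
  suff z0 : z = 0 by rewrite -zm z0 linear0.
  by apply: injfan; apply: injP; rewrite -rep_fan_nat zm im0 !linear0.
pose N := rep_coker i; pose p := rep_cproj i.
have psurj v y : exists x, p v x = y := cproj_surj y.
have pker v x : p v x = 0 <-> exists m, i v m = x := cproj_eq0 _ x.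
have pfan v y : exists x, rep_dsum_fun p v x = y.
  by apply: dsum_fun_lift => a; exact: psurj.
exists P, N, i, p; split=> // [v|v]; last first.
  by split=> [x|y /pker//]; apply/pker; exists x.
have Kg : is_gproj (C := ModCat R) (K v) := ge_gproj (D v).
have [ej je] : exact_at (j v) (e v) := ge_exact (D v).
have esurj y : exists x, e v x = y := ge_surj y.
have topE y : induced_top W v y = 0 -> exists x, rep_fan P v x = y.
  by move=> y0; exists (induced_drop W v y); rewrite [RHS]induced_decomp y0 linear0 addr0.
split.
  apply: lin_inj => y; have [y' <-] := pfan v y; rewrite -rep_fan_nat => /pker[m im].
  have := iT v m; rewrite im induced_top_fan => /esym/injj/kerM[z zm].
  have -> : y' = rep_dsum_fun i v z by apply: injP; rewrite -rep_fan_nat zm.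
  apply: dsum_eqP => a; rewrite -!dsum_prE !dsum_pr_fun linear0.
  by apply/pker; eexists.
(* P v -> W v -> K v kills the image of M v, and the map q that it induces on N v
   kills the image of the fan of N; the map s induced by q is an isomorphism. *)
have [x|q qE] := lin_factor (h := lin_comp (e v) (induced_top W v)) (psurj v).
  by move=> /pker[m <-] /=; rewrite iT ej.
have qfan y : q (rep_fan N v y) = 0.
  by have [y' <-] := pfan v y; rewrite -rep_fan_nat qE /= induced_top_fan linear0.
have [y /cproj_eq0[z <-]|s sE] := lin_factor (h := q) (@cproj_surj _ _ _ (rep_fan N v)).
  exact: qfan.
apply: (gproj_iso (s := s)) Kg; last first.
  move=> y; have [w <-] := esurj y.
  by exists (cproj (rep_fan N v) (p v (induced_in W v w))); rewrite sE qE /= induced_topK.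
apply: lin_inj => c; have [n <-] := cproj_surj c; have [x <-] := psurj v n.
rewrite sE qE /= => /je[c' c'E]; have [m mE] := cproj_surj c'.
have /topE[y yE] : induced_top W v (x - i v m) = 0.
  by rewrite linearB /= iT mE c'E subrr.
apply/cproj_eq0; exists (rep_dsum_fun p v y); rewrite -rep_fan_nat yE linearB /=.
by rewrite [X in _ - X](_ : _ = 0) ?subr0 //; apply/pker; exists m.
Qed.

End Coresolution.

(** * Complete resolutions of representations *)

Section Splice.
Variables (Q : quiver) (R : pzRingType).
Hypothesis hQ : sink_projective Q.

Record proj_ses (A B : rep Q R) := ProjSes {
  ps_mid : rep Q R;
  ps_in : rep_hom A ps_mid;
  ps_out : rep_hom ps_mid B;
  ps_projective : is_projective (C := RepCat Q R) ps_mid;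
  ps_inj : forall v, injective (ps_in v);
  ps_exact : forall v, exact_at (ps_in v) (ps_out v);
  ps_surj : forall v y, exists x, ps_out v x = y
}.

Lemma proj_ses_left (X : rep Q R) : exists K, inhabited (proj_ses K X).
Proof.
have [P [p [Pp psurj]]] := enough_projectives X hQ.
exists (rep_ker p); constructor; exists P (rep_ker_incl p) p => // v.
by split=> [x|y /ker_inclE//]; exact: ker_inclK.
Qed.

Lemma proj_ses_right (M : {X : rep Q R | fan_gproj X}) :
  exists N : {X : rep Q R | fan_gproj X}, inhabited (proj_ses (sval M) (sval N)).
Proof.
case: M => M Mg; have [P [N [i [p [Pp Ng inji ip psurj]]]]] := fan_gproj_step hQ Mg.
by exists (exist _ N Ng); constructor; exists P i p.
Qed.

(** The syzygies in all degrees, with G 0 = M. Only the existence of short exact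
sequences between G z and G (z + 1) is asserted, so that the equations between
integers can be rewritten without transporting morphisms. *)
Lemma proj_ses_chain (M : rep Q R) : fan_gproj M ->
  exists G : int -> rep Q R, G 0 = M /\ forall z, inhabited (proj_ses (G z) (G (z + 1))).
Proof.
move=> Mg.
have /choice[l lP] := proj_ses_left; have /choice[r rP] := proj_ses_right.
pose rn n := iter n r (exist _ M Mg); pose ln n := iter n l M.
exists (fun z => match z with Posz n => sval (rn n) | Negz n => ln n.+1 end).
split=> // -[n|[|n]].
- have -> : Posz n + 1 = Posz n.+1 by rewrite -addn1 PoszD.
  exact: rP.
- exact: lP.
have -> : Negz n.+1 + 1 = Negz n by rewrite !NegzE -addn1 PoszD opprD subrK.
exact: lP.
Qed.

(** Splicing the short exact sequences gives an exact complex of projectives, and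
this suffices by [rep_gproj]. *)
Lemma fan_gproj_gproj (M : rep Q R) : left_gorenstein R ->
  fan_gproj M -> is_gproj (C := RepCat Q R) M.
Proof.
move=> gorR /proj_ses_chain[G [GM ses]].
have D z : proj_ses (G z) (G (z + 1)).
  have /cid[D _] : exists _ : proj_ses (G z) (G (z + 1)), True.
    by case: (ses z) => D; exists D.
  exact: D.
pose P z := ps_mid (D z).
pose d z : rep_hom (P z) (P (z + 1)) := rep_comp (ps_in (D (z + 1))) (ps_out (D z)).
have kerd z v x : d z v x = 0 -> ps_out (D z) v x = 0.
  by move=> dx; apply: (@ps_inj _ _ (D (z + 1)) v); rewrite linear0; exact: dx.
have ex z : is_exact (C := RepCat Q R) (d z) (d (z + 1)).
  apply/rep_exactP => v; have [oi io] := ps_exact (D (z + 1)) v.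
  split=> [x|y /kerd/io[x <-]]; first by rewrite /= oi linear0.
  by have [w <-] := ps_surj (D z) x; exists w.
subst M; apply: (@rep_gproj Q R hQ gorR P d _ ex _ (ps_in (D 0))).
  by move=> z; exact: (@ps_projective _ _ (D z)).
apply/rep_kernelP; split=> v; first exact: (@ps_inj _ _ (D 0) v).
have [oi io] := ps_exact (D 0) v.
by split=> [x|y /kerd/io//]; rewrite /= oi linear0.
Qed.

End Splice.

Theorem corollary6p4 (Q : quiver) (R : pzRingType)
    (hQ : sink_projective Q) (hR : gorenstein_ring R) (M : rep Q R) :
  is_gproj (C := RepCat Q R) M <->
  forall v : vertex Q,
    [/\ is_gproj (C := ModCat R) (M v),
        is_short_exact (C := ModCat R) (rep_fan M v) (coker_pi (rep_fan M v)) &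
        is_gproj (C := ModCat R) (coker (rep_fan M v))].
Proof.
have gorR : left_gorenstein R := proj1 hR.
split=> [[P [d [k [Pp ex kk _]]]] v|Mv]; last first.
  apply: fan_gproj_gproj => // v; case: (Mv v) => _ [/mod_monoP inj _ _] Cg.
  by split.
split.
- exact: (rep_gproj_at hQ gorR Pp ex kk v).
- split; first exact/mod_monoP/(rep_gproj_fan_inj hQ Pp kk (v := v)).
    apply/mod_exactP; split=> [x|y]; first exact: cprojK.
    by move/cproj_eq0.
  exact/mod_epiP/cproj_surj.
- exact: (rep_gproj_fan_coker hQ gorR Pp ex kk v).
Qed.
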